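(* Let $a>b>0$ and $\theta=1/2$, and let $h^k$, $k\ge 0$, be the interface errors generated from an initial guess $h^0$ by the Dirichlet--Neumann waveform relaxation (DNWR) iteration for the one-dimensional heat equation (error equations) on $(-a,b)$, with Dirichlet subdomain $(-a,0)$ and Neumann subdomain $(0,b)$. Then for $t\in(0,\infty)$ the error satisfies, for $k=1,2,3,\ldots$, the linear estimate $$\|h^k\|_{L^\infty(0,\infty)}\le\left(\frac{a-b}{2a}\right)^k\|h^0\|_{L^\infty(0,\infty)},$$ and on any finite time interval $(0,T)$, $T>0$, it satisfies, for $k=1,2,3,\ldots$, the superlinear estimate $$\|h^k\|_{L^\infty(0,T)}\le\left(\frac{a-b}{a}\right)^k\operatorname{erfc}\left(\frac{kb}{2\sqrt T}\right)\|h^0\|_{L^\infty(0,T)}.$$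
   Context: DNWR iteration (error equations, heat equation $\partial_t u=\partial_{xx}u$ on $(-a,b)$ with $a,b>0$, interface at $x=0$, zero source, zero initial data and zero outer boundary data). Given a bounded initial guess $h^0(t)$ on the interface and a relaxation parameter $\theta\in(0,1]$, for $k=1,2,\ldots$ solve first the Dirichlet problem $$\partial_t u_1^k-\partial_{xx}u_1^k=0 \text{ on } (-a,0),\quad u_1^k(x,0)=0,\quad u_1^k(-a,t)=0,\quad u_1^k(0,t)=h^{k-1}(t),$$ then the Neumann problem $$\partial_t u_2^k-\partial_{xx}u_2^k=0 \text{ on } (0,b),\quad u_2^k(x,0)=0,\quad \partial_x u_2^k(0,t)=\partial_x u_1^k(0,t),\quad u_2^k(b,t)=0,$$ and update $h^k(t)=\theta u_2^k(0,t)+(1-\theta)h^{k-1}(t)$. The iteration is understood through the Laplace transform in time, $\hat u(x,s)=\int_0^\infty e^{-st}u(x,t)\,dt$, $\operatorname{Re}(s)>0$: $(s-\partial_{xx})\hat u_1^k=0$ on $(-a,0)$, $\hat u_1^k(-a,s)=0$, $\hat u_1^k(0,s)=\hat h^{k-1}(s)$; $(s-\partial_{xx})\hat u_2^k=0$ on $(0,b)$, $\partial_x\hat u_2^k(0,s)=\partial_x\hat u_1^k(0,s)$, $\hat u_2^k(b,s)=0$; $\hat h^k(s)=\theta\hat u_2^k(0,s)+(1-\theta)\hat h^{k-1}(s)$; and $h^k$ is the inverse Laplace transform of $\hat h^k$. If $h^0$ is given only on $(0,T)$, it is extended by zero (the values of $h^k$ on $(0,T)$ depend only on $h^0$ on $(0,T)$).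 The exact error solution is zero, so $h^k$ is the error on the interface. $\operatorname{erfc}(x)=\frac{2}{\sqrt\pi}\int_x^\infty e^{-t^2}\,dt$. *)

(* Defs.v *)
From HB Require Import structures.
From mathcomp Require Import all_boot all_order all_algebra.
From mathcomp Require Import all_classical all_reals all_analysis.
From mathcomp.real_closed Require Import complex.

Set Implicit Arguments.
Unset Strict Implicit.
Unset Printing Implicit Defensive.

Import Order.TTheory GRing.Theory Num.Theory.
Import numFieldNormedType.Exports.

Local Open Scope classical_set_scope.
Local Open Scope ring_scope.
Local Open Scope complex_scope.

(* The library's global Re and Im are those of numClosedFieldType, with values in
   R[i]; here the R-valued projections are needed. *)
Local Notation Re := complex.Re.
Local Notation Im := complex.Im.

Definition erfc (R : realType) (x : R) : R :=
  2 / Num.sqrt pi * \int[lebesgue_measure]_(t in `]x, +oo[) expR (- t ^+ 2).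

(* The patch [f \_ D] is 0 outside D, so only the values of f on D matter. *)
Definition Linfty_norm (R : realType) (D : set R) (f : R -> R) : \bar R :=
  Lnorm (@lebesgue_measure R) +oo%E (EFin \o (f \_ D)).

(* Complex-valued functions of a real variable are differentiated and
   integrated componentwise. *)

Definition cderivable (R : realType) (f : R -> R[i]) (x : R) : Prop :=
  derivable (fun y => Re (f y)) x 1 /\ derivable (fun y => Im (f y)) x 1.

Definition cderive (R : realType) (f : R -> R[i]) (x : R) : R[i] :=
  derive1 (fun y => Re (f y)) x +i* derive1 (fun y => Im (f y)) x.

Definition is_left_cderive (R : realType) (f : R -> R[i]) (x : R) (l : R[i]) :=
  ((Re (f (x + e)) - Re (f x)) / e @[e --> 0^'-] --> Re l) /\
  ((Im (f (x + e)) - Im (f x)) / e @[e --> 0^'-] --> Im l).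

Definition is_right_cderive (R : realType) (f : R -> R[i]) (x : R) (l : R[i]) :=
  ((Re (f (x + e)) - Re (f x)) / e @[e --> 0^'+] --> Re l) /\
  ((Im (f (x + e)) - Im (f x)) / e @[e --> 0^'+] --> Im l).

Definition cexp (R : realType) (z : R[i]) : R[i] :=
  (expR (Re z) * cos (Im z)) +i* (expR (Re z) * sin (Im z)).

Definition laplace (R : realType) (f : R -> R) (s : R[i]) : R[i] :=
  (\int[lebesgue_measure]_(t in `]0, +oo[) Re (cexp (- s * t%:C) * (f t)%:C))
  +i*
  (\int[lebesgue_measure]_(t in `]0, +oo[) Im (cexp (- s * t%:C) * (f t)%:C)).

(* f is an inverse Laplace transform of F: the Laplace integral of f converges
   absolutely on Re s > 0 and equals F there (this determines f a.e.). *)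
Definition is_inverse_laplace (R : realType) (F : R[i] -> R[i]) (f : R -> R) :=
  [/\ measurable_fun (`]0, +oo[ : set R) f,
      forall sigma : R, 0 < sigma ->
        (@lebesgue_measure R).-integrable `]0, +oo[
          (fun t : R => (expR (- sigma * t) * f t)%:E) &
      forall s : R[i], 0 < Re s -> laplace f s = F s].

(* (s - d^2/dx^2) u = 0 on ]x1, x2[, with u continuous up to the end points so
   that its boundary values are meaningful. *)
Definition heat_laplace_sol (R : realType) (x1 x2 : R) (s : R[i])
    (u : R -> R[i]) : Prop :=
  [/\ {within `[x1, x2], continuous (fun x => Re (u x))},
      {within `[x1, x2], continuous (fun x => Im (u x))} &
      forall x, x1 < x < x2 ->
        [/\ cderivable u x, cderivable (cderive u) x &
            s * u x - cderive (cderive u) x = 0]].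

Definition dirichlet_problem (R : realType) (a : R) (s g : R[i])
    (u : R -> R[i]) : Prop :=
  [/\ heat_laplace_sol (- a) 0 s u, u (- a) = 0 & u 0 = g].

Definition neumann_problem (R : realType) (b : R) (s p : R[i])
    (u : R -> R[i]) : Prop :=
  [/\ heat_laplace_sol 0 b s u, is_right_cderive u 0 p & u b = 0].

(* [h k] is the interface error h^k; [H k], [u1 k], [u2 k] are the Laplace
   transforms of h^k, u_1^k, u_2^k (the values of u1, u2 at k = 0 are unused),
   and p is the common interface flux of u_1^k and u_2^k. *)
Definition dnwr_iteration (R : realType) (a b theta : R) (h : nat -> R -> R) :
    Prop :=
  (Linfty_norm `]0%R, +oo[ (h 0%N) < +oo)%E /\
  exists (H : nat -> R[i] -> R[i]) (u1 u2 : nat -> R -> R[i] -> R[i]),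
    (forall k, is_inverse_laplace (H k) (h k)) /\
    (forall (k : nat) (s : R[i]), 0 < Re s ->
      [/\ dirichlet_problem a s (H k s) (fun x => u1 k.+1 x s),
          exists2 p : R[i], is_left_cderive (fun x => u1 k.+1 x s) 0 p &
            neumann_problem b s p (fun x => u2 k.+1 x s) &
          H k.+1 s = theta%:C * u2 k.+1 0 s + (1 - theta)%:C * H k s]).

(* Main.v *)
Require Import Defs.
From mathcomp Require Import all_boot all_order all_algebra.
From mathcomp Require Import all_classical all_reals all_analysis.
From mathcomp Require Import measurable_realfun ess_sup_inf.
From mathcomp.real_closed Require Import complex.
From mathcomp Require Import ring lra.

(** For real [s > 0] and [z = sqrt s] the transmission problems give
    [H_(k+1) = Q H_k] with [Q = sinh ((a - b) z) / sinh (a z) * sinh (b z) / sinh (2 b z)].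
    The transform of the desired bound minus that of [+- h^k] is shown to be completely
    monotone, and a function with completely monotone Laplace transform is nonnegative
    a.e. (Hausdorff moments: Bernstein polynomials in [expR (- t)], then Lebesgue
    differentiation), so no convolution kernel is ever constructed.  Complete monotonicity of
    [sinh (c z) / sinh (a z)] and of [(c / a - sinh (c z) / sinh (a z)) / s] comes from
    the discretized problem, a product of continued fractions.
    Linear bound: [M c / s -+ Q^k H_0 = Q^k (M / s -+ H_0) + M (c - Q^k) / s] with [c = Q(0)^k].
    Superlinear bound: [expR (- (b z)) - sinh (b z) / sinh (2 b z)] is completely monotone,
    and [expR (- (k b z)) / s] is the transform of [erfc (k b / (2 sqrt t))]. *)

Set Implicit Arguments.
Unset Strict Implicit.
Unset Printing Implicit Defensive.

Import Order.TTheory GRing.Theory Num.Theory.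
Import numFieldNormedType.Exports.

Local Open Scope classical_set_scope.
Local Open Scope ring_scope.
Local Open Scope complex_scope.

(** * Completely monotone functions *)

Section completely_monotone.
Variable R : realType.
Implicit Types (f g : R -> R) (s m : R) (n : nat).

(** Positivity of the transform says nothing about the sign of a function; complete monotonicity
    does, and it survives sums, products and limits. It is phrased with unit differences instead of
    derivatives because, with [x = expR (- t)], the shift [s + 1] multiplies [f t] by [x] and the
    difference multiplies it by [1 - x]: these two factors generate the Bernstein basis. Real [s]
    suffices for this, and at real [s] the real parts of the subdomain solutions satisfy the same
    problems by themselves, so complex analysis never enters. The choice [theta = 1/2] turns the
    symbol [1 - theta - theta * tanh (b z) / tanh (a z)] into a product, and [b < a] makes the first
    factor [sinh ((a - b) z) / sinh (a z)] a ratio with [0 < a - b < a]. The factors tend to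
    [(a - b) / a] and [1 / 2] at [s = 0]. The superlinear bound gives up the factor [1 / 2]: it
    replaces [1 / (2 cosh (b z))] by [expR (- (b z))], of mass 1, whose powers carry the decay in
    time. Data after time [T] must not influence the bound before [T]; a majorant with a jump at [T]
    expresses this causality. *)

Definition fdiff f s := f s - f (s + 1).

(** Weaker than the classical notion (any nonnegative function of period 1 passes at every level),
    yet sufficient for the moment argument. The explicit level [n] is what the inductions run on. *)
Fixpoint cmn n f : Prop :=
  (forall s, 0 < s -> 0 <= f s) /\ (if n is n'.+1 then cmn n' (fdiff f) else True).

Definition cm f := forall n, cmn n f.

Lemma cmn_ge0 n f s : cmn n f -> 0 < s -> 0 <= f s.
Proof. by case: n => [|n] [f0 _]; exact: f0. Qed.

Lemma cm_ge0 f s : cm f -> 0 < s -> 0 <= f s.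
Proof. by move=> /(_ 0%N); exact: cmn_ge0. Qed.

Lemma eq_cmn n f g : (forall s, 0 < s -> f s = g s) -> cmn n f -> cmn n g.
Proof.
elim: n f g => [|n IH] f g fg /= [f0 Df].
  by split => // s s0; rewrite -fg// f0.
split=> [s s0|]; first by rewrite -fg// f0.
by apply: IH Df => s s0; rewrite /fdiff !fg// addr_gt0.
Qed.

Lemma eq_cm f g : (forall s, 0 < s -> f s = g s) -> cm f -> cm g.
Proof. by move=> fg cf n; exact: eq_cmn (cf n). Qed.

Lemma cmnW n f : cmn n.+1 f -> cmn n f.
Proof.
elim: n f => [|n IH] f [f0 Df]; first by [].
by split => //; exact: IH.
Qed.

Lemma cmn_shift n f : cmn n f -> cmn n (fun s => f (s + 1)).
Proof.
elim: n f => [|n IH] f [f0 Df].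
  by split => // s s0; rewrite f0// addr_gt0.
by split=> [s s0|]; [rewrite f0// addr_gt0|exact: (IH _ Df)].
Qed.

Lemma cmnD n f g : cmn n f -> cmn n g -> cmn n (fun s => f s + g s).
Proof.
elim: n f g => [|n IH] f g [f0 Df] [g0 Dg].
  by split => // s s0; rewrite addr_ge0 ?f0 ?g0.
split=> [s s0|]; first by rewrite addr_ge0 ?f0 ?g0.
by apply: eq_cmn (IH _ _ Df Dg) => s _; rewrite /fdiff; ring.
Qed.

Lemma cmnM n f g : cmn n f -> cmn n g -> cmn n (fun s => f s * g s).
Proof.
elim: n f g => [|n IH] f g cf cg.
  by case: cf cg => f0 _ [g0 _]; split => // s s0; rewrite mulr_ge0 ?f0 ?g0.
have [[f0 Df] [g0 Dg]] := (cf, cg).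
split=> [s s0|]; first by rewrite mulr_ge0 ?f0 ?g0.
(* Discrete Leibniz rule: the difference of [f g] is [fdiff f * g] plus the shifted [f] times
   [fdiff g]. *)
apply: eq_cmn (cmnD (IH _ _ Df (cmnW cg)) (IH _ _ (cmn_shift (cmnW cf)) Dg)).
by move=> s _; rewrite /fdiff; ring.
Qed.

Lemma cmD f g : cm f -> cm g -> cm (fun s => f s + g s).
Proof. by move=> cf cg n; exact: cmnD. Qed.

Lemma cmM f g : cm f -> cm g -> cm (fun s => f s * g s).
Proof. by move=> cf cg n; exact: cmnM. Qed.

Lemma cm_cst m : 0 <= m -> cm (fun=> m).
Proof.
move=> m0 n; elim: n m m0 => [|n IH] m m0; split => //.
by apply: eq_cmn (IH 0 _) => // s _; rewrite /fdiff subrr.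
Qed.

Lemma cmZ m f : 0 <= m -> cm f -> cm (fun s => m * f s).
Proof. by move=> m0 cf; exact: cmM (cm_cst m0) cf. Qed.

Lemma cmX f n : cm f -> cm (fun s => f s ^+ n).
Proof.
move=> cf; elim: n => [|n IH]; first exact: cm_cst.
by apply: eq_cm (cmM cf IH) => s _; rewrite exprS.
Qed.

Lemma cm_sum n (F : nat -> R -> R) : (forall i, cm (F i)) ->
  cm (fun s => \sum_(i < n) F i s).
Proof.
move=> cF; elim: n => [|n IH].
  by apply: eq_cm (cm_cst (lexx 0)) => s _; rewrite big_ord0.
by apply: eq_cm (cmD IH (cF n)) => s _; rewrite big_ord_recr.
Qed.

Lemma cm_inv m e : 0 <= m -> 0 < e -> cm (fun s => (m + e * s)^-1).
Proof.
move=> m0 e0 n; elim: n m m0 => [|n IH] m m0.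
  by split => // s s0; rewrite invr_ge0 addr_ge0// mulr_ge0 ?ltW.
split=> [s s0|]; first by rewrite invr_ge0 addr_ge0// mulr_ge0 ?ltW.
(* The difference of [(m + e s)^-1] is [e] times this function times its own shift. *)
apply: eq_cmn (cmnM (cmnM (cm_cst (ltW e0) n) (IH _ m0)) (cmn_shift (IH _ m0))).
move=> s s0; rewrite /fdiff.
have ? : 0 < m + e * s by rewrite ltr_wpDl// mulr_gt0.
have ? : 0 < m + e * (s + 1) by rewrite ltr_wpDl// mulr_gt0// addr_gt0.
by field; rewrite !gt_eqF.
Qed.

Lemma cm_invs : cm (fun s => s^-1).
Proof. by apply: eq_cm (cm_inv (lexx 0) ltr01) => s _; rewrite add0r mul1r. Qed.

Lemma cm_expR m : 0 <= m -> cm (fun s => expR (- (m * s))).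
Proof.
move=> m0; elim=> [|n IH]; first by split => // s _; exact: expR_ge0.
split=> [s _|]; first exact: expR_ge0.
have p0 : 0 <= 1 - expR (- m) by rewrite subr_ge0 -expR0 ler_expR oppr_le0.
apply: eq_cmn (cmnM (cm_cst p0 n) IH) => s _.
by rewrite /fdiff mulrDr mulr1 opprD expRD; ring.
Qed.

(** Each level involves finitely many values of the function, so pointwise convergence is enough. *)
Lemma cm_lim (u : nat -> R -> R) f : (\forall n \near \oo, cm (u n)) ->
  (forall s, 0 < s -> u n s @[n --> \oo] --> f s) -> cm f.
Proof.
move=> cu + k; have {}cu : \forall n \near \oo, cmn k (u n).
  by apply: filterS cu => n; exact.
have lim0 (v : nat -> R) (l : R) : (\forall n \near \oo, 0 <= v n) ->
    v n @[n --> \oo] --> l -> 0 <= l.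
  by move=> v0 vl; rewrite -(cvg_lim _ vl)//; apply: limr_ge => //; exact: cvgP vl.
elim: k u f cu => [|k IH] u f cu uf.
  split => // s s0; apply: lim0 (uf _ s0).
  by apply: filterS cu => n [+ _]; exact.
split=> [s s0|].
  by apply: lim0 (uf _ s0); apply: filterS cu => n [+ _]; exact.
apply: (IH (fun n => fdiff (u n))) => [|s s0]; first by apply: filterS cu => n [].
by apply: cvgB; apply: uf => //; rewrite addr_gt0.
Qed.

(* If [f] is the Laplace transform of a positive measure of mass [m], then
   [(m - f s) / s] is the transform of the tail of that measure. *)
Definition cm_mass f m := cm f /\ cm (fun s => (m - f s) / s).

Lemma cm_mass_le f m s : cm_mass f m -> 0 < s -> 0 <= f s <= m.
Proof.
move=> [cf cr] s0; rewrite (cm_ge0 cf)//=.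
by have := cm_ge0 cr s0; rewrite pmulr_lge0 ?invr_gt0// subr_ge0.
Qed.

Lemma cm_mass_ge0 f m : cm_mass f m -> 0 <= m.
Proof. by move=> /cm_mass_le /(_ ltr01) /andP[]; exact: le_trans. Qed.

Lemma eq_cm_mass f g m : (forall s, 0 < s -> f s = g s) ->
  cm_mass f m -> cm_mass g m.
Proof.
move=> fg [cf cr]; split; first exact: eq_cm cf.
by apply: eq_cm cr => s s0; rewrite fg.
Qed.

Lemma cm_mass_cst m : 0 <= m -> cm_mass (fun=> m) m.
Proof.
move=> m0; split; first exact: cm_cst.
by apply: eq_cm (cm_cst (lexx 0)) => s _; rewrite subrr mul0r.
Qed.

(** The tails combine as [(m p - f g) / s = p (m - f) / s + f (p - g) / s]. *)
Lemma cm_massM f g m p : cm_mass f m -> cm_mass g p ->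
  cm_mass (fun s => f s * g s) (m * p).
Proof.
move=> mf mg; have [[cf crf] [cg crg]] := (mf, mg); split; first exact: cmM.
apply: eq_cm (cmD (cmZ (cm_mass_ge0 mg) crf) (cmM cf crg)) => s s0.
by field; rewrite gt_eqF.
Qed.

Lemma cm_massX f m n : cm_mass f m -> cm_mass (fun s => f s ^+ n) (m ^+ n).
Proof.
move=> mf; elim: n => [|n IH]; first exact: cm_mass_cst.
by rewrite exprS; apply: eq_cm_mass (cm_massM mf IH) => s _; rewrite exprS.
Qed.

Lemma cm_mass_lim (u : nat -> R -> R) (l : nat -> R) f m :
  (\forall n \near \oo, cm_mass (u n) (l n)) ->
  (forall s, 0 < s -> u n s @[n --> \oo] --> f s) -> l n @[n --> \oo] --> m ->
  cm_mass f m.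
Proof.
move=> cu uf lm; split; first by apply: cm_lim uf; apply: filterS cu => n [].
apply: (@cm_lim (fun n s => (l n - u n s) / s)).
  by apply: filterS cu => n [].
by move=> s s0; apply: cvgM; [apply: cvgB => //; exact: uf|exact: cvg_cst].
Qed.

(** One level of a continued fraction. With [A = (2 + e s)^-1] the function is the geometric series
    of [A (A f)^i], where [A f < 1] because [f <= m <= 1]; the new mass is obtained by setting
    [s = 0] and [f = m]. *)
Lemma cm_mass_step f m e : 0 < e -> cm_mass f m -> m <= 1 ->
  cm_mass (fun s => (2 + e * s - f s)^-1) (2 - m)^-1.
Proof.
move=> e0 mf m1; have [cf cr] := mf.
have fb s : 0 < s -> 0 <= f s <= 1.
  by move=> s0; have /andP[-> /le_trans->] := cm_mass_le mf s0.
have cinv : cm (fun s => (2 + e * s - f s)^-1).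
  pose A s := (2 + e * s)^-1.
  have cA : cm A by exact: cm_inv.
  apply: (@cm_lim (fun n s => A s * \sum_(i < n) (A s * f s) ^+ i)).
    apply: nearW => n; apply: cmM => //; apply: (@cm_sum n (fun i s => (A s * f s) ^+ i)) => i;
    by apply: cmX; exact: cmM.
  move=> s s0; have /andP[f0 f1] := fb s s0.
  have es : 0 < e * s by rewrite mulr_gt0.
  have A0 : 0 < A s by rewrite invr_gt0 addr_gt0.
  have Af0 : 0 <= A s * f s by rewrite mulr_ge0// ltW.
  have Af1 : A s * f s < 1.
    by rewrite /A mulrC ltr_pdivrMr ?mul1r; lra.
  have -> : (2 + e * s - f s)^-1 = A s * (1 - A s * f s)^-1.
    by rewrite /A; field; rewrite !gt_eqF//; lra.
  apply: cvgM; first exact: cvg_cst.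
  have := @cvg_geometric_series R 1 (A s * f s).
  rewrite ger0_norm// div1r => /(_ Af1); apply: cvg_trans.
  apply: near_eq_cvg; apply: nearW => n /=.
  by rewrite /series/= big_mkord; apply: eq_bigr => i _; rewrite /geometric/= mul1r.
split => //.
(* The new tail equals [(2 - m)^-1 * (e + (m - f) / s) * (2 + e s - f)^-1]. *)
have m2 : 0 <= (2 - m)^-1 by rewrite invr_ge0; lra.
apply: eq_cm (cmM (cmZ m2 (cmD (cm_cst (ltW e0)) cr)) cinv) => s s0.
have /andP[f0 f1] := fb s s0; have es : 0 < e * s by rewrite mulr_gt0.
by field; rewrite !gt_eqF//; lra.
Qed.

End completely_monotone.

(** * Hyperbolic ratios *)

Section hyperbolic.
Variable R : realType.
Implicit Types (x y : R).

Definition sinh x := (expR x - expR (- x)) / 2.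
Definition cosh x := (expR x + expR (- x)) / 2.

Lemma sinh0 : sinh 0 = 0.
Proof. by rewrite /sinh oppr0 subrr mul0r. Qed.

Lemma sinh_gt0 x : 0 < x -> 0 < sinh x.
Proof. by move=> x0; rewrite divr_gt0// subr_gt0 ltr_expR; lra. Qed.

Lemma cosh_gt0 x : 0 < cosh x.
Proof. by rewrite divr_gt0// addr_gt0// expR_gt0. Qed.

Lemma sinhD x y : sinh (x + y) = sinh x * cosh y + cosh x * sinh y.
Proof. by rewrite /sinh /cosh opprD !expRD; lra. Qed.

Lemma sinhB x y : sinh (x - y) = sinh x * cosh y - cosh x * sinh y.
Proof. by rewrite /sinh /cosh opprB addrC !expRD; lra. Qed.

Lemma cosh2 x : cosh (2 * x) = 1 + 2 * sinh x ^+ 2.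
Proof.
have e : expR x * expR (- x) = 1 by rewrite -expRD subrr expR0.
have -> : 2 * x = x + x by lra.
rewrite /cosh /sinh opprD !expRD; nra.
Qed.

Lemma continuous_sinh : continuous sinh.
Proof.
move=> x; apply: cvgM; last exact: cvg_cst.
apply: cvgB; first exact: continuous_expR.
by apply: (@continuous_comp _ _ _ -%R expR); [exact: cvgN|exact: continuous_expR].
Qed.

Definition asinh x := ln (x + Num.sqrt (x ^+ 2 + 1)).

Lemma asinhK x : 0 < x -> sinh (asinh x) = x.
Proof.
move=> x0; rewrite /sinh /asinh expRN lnK; last first.
  by rewrite posrE ltr_wpDr// sqrtr_ge0.
set r := Num.sqrt _; have r2 : r ^+ 2 = x ^+ 2 + 1.
  by rewrite sqr_sqrtr// addr_ge0// sqr_ge0.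
have r0 : 0 <= r by exact: sqrtr_ge0.
have xr : 0 < x + r by rewrite ltr_wpDr.
have -> : (x + r)^-1 = r - x.
  by apply: (mulfI (lt0r_neq0 xr)); rewrite divff ?gt_eqF//; nra.
lra.
Qed.

(** This bound and the lower one below agree to first order at 0, which is what the limit of
    [n * asinh (y / n)] requires. *)
Lemma asinh_le x : 0 <= x -> asinh x <= x + x ^+ 2 / 2.
Proof.
move=> x0; rewrite /asinh; have x2 := sqr_ge0 x.
apply: (@le_trans _ _ (ln (1 + (x + x ^+ 2 / 2)))); last by apply: le_ln1Dx; lra.
have h : Num.sqrt (x ^+ 2 + 1) <= 1 + x ^+ 2 / 2.
  rewrite -(@ler_pXn2r _ 2)// ?nnegrE ?sqrtr_ge0//; last lra.
  by rewrite sqr_sqrtr; [nra|lra].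
have h0 : 0 < Num.sqrt (x ^+ 2 + 1) by rewrite sqrtr_gt0; lra.
by rewrite ler_ln ?posrE; lra.
Qed.

Lemma asinh_ge x : 0 <= x -> x / (1 + x) <= asinh x.
Proof.
move=> x0; have x1 : 0 < 1 + x by lra.
apply: (@le_trans _ _ (ln (1 + x))).
  rewrite -[leRHS]opprK -lnV ?posrE// lerNr.
  have e : (1 + x)^-1 = 1 - x / (1 + x) by field; rewrite gt_eqF.
  by rewrite [in leLHS]e; apply: le_ln1Dx; rewrite ltrN2 ltr_pdivrMr// mul1r; lra.
have h : 1 <= Num.sqrt (x ^+ 2 + 1).
  by rewrite -[leLHS]sqrtr1 ler_sqrt; have := sqr_ge0 x; lra.
by rewrite ler_ln ?posrE//; lra.
Qed.

Lemma cvg_asinh y : 0 <= y ->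
  n.+1%:R * asinh (y / n.+1%:R) @[n --> \oo] --> y.
Proof.
move=> y0; have c0 : n.+1%:R^-1 @[n --> \oo] --> (0 : R) by exact: cvg_harmonic.
have lo : y / (1 + y * n.+1%:R^-1) @[n --> \oo] --> y.
  suff : y / (1 + y * n.+1%:R^-1) @[n --> \oo] --> y / (1 + y * 0).
    by rewrite mulr0 addr0 divr1.
  apply: cvgM; first exact: cvg_cst.
  apply: cvgV; first by rewrite mulr0 addr0 oner_eq0.
  by apply: cvgD; [|apply: cvgM => //]; exact: cvg_cst.
have hi : y + y ^+ 2 / 2 * n.+1%:R^-1 @[n --> \oo] --> y.
  suff : y + y ^+ 2 / 2 * n.+1%:R^-1 @[n --> \oo] --> y + y ^+ 2 / 2 * 0.
    by rewrite mulr0 addr0.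
  by apply: cvgD; [|apply: cvgM => //]; exact: cvg_cst.
apply: squeeze_cvgr lo hi; apply: nearW => n.
have n0 : 0 < n.+1%:R :> R by rewrite ltr0n.
have yn0 : 0 <= y / n.+1%:R by rewrite divr_ge0// ltW.
apply/andP; split.
  by rewrite -ler_pdivrMl//; apply: le_trans (asinh_ge yn0); rewrite mulrA [_^-1 * y]mulrC.
rewrite -ler_pdivlMl//; apply: le_trans (asinh_le yn0) _.
rewrite le_eqVlt; apply/orP; left; apply/eqP; field.
by rewrite gt_eqF.
Qed.

End hyperbolic.

(** * Discrete Dirichlet problems and their continuum limits *)

Section sinh_ratio.
Variable R : realType.
Implicit Types (a c s e : R).

(** The quotient [v n / v n.+1] for [v n.+2 = (2 + e s) v n.+1 - v n], [v 0 = 0]: the three-point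
    scheme for [s - d^2/dx^2], with [e] the squared mesh width. *)
Fixpoint sinh_step e n s : R :=
  if n is n'.+1 then (2 + e * s - sinh_step e n' s)^-1 else 0.

Lemma cm_mass_sinh_step e n : 0 < e -> cm_mass (sinh_step e n) (n%:R / n.+1%:R).
Proof.
move=> e0; elim: n => [|n IH].
  by rewrite mul0r; exact: (cm_mass_cst (lexx 0)).
have n1 : n%:R / n.+1%:R <= 1 :> R by rewrite ler_pdivrMr ?ltr0n// mul1r ler_nat.
have -> : n.+1%:R / n.+2%:R = (2 - n%:R / n.+1%:R)^-1 :> R.
  have n0 : 0 <= n%:R :> R by rewrite ler0n.
  by rewrite -[n.+2]addn1 -[n.+1]addn1 !natrD; field; rewrite !gt_eqF//; lra.
exact: cm_mass_step IH n1.
Qed.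

Lemma sinh_stepE e n s (d : R) : 0 < d -> 2 * cosh d = 2 + e * s ->
  sinh_step e n s = sinh (n%:R * d) / sinh (n.+1%:R * d).
Proof.
move=> d0 de; elim: n => [|n IH]; first by rewrite mul0r sinh0 mul0r.
have sn k : 0 < sinh (k.+1%:R * d) by rewrite sinh_gt0// mulr_gt0// ltr0n.
rewrite /= IH -de.
have := sn n; have := sn n.+1.
have -> : n.+2%:R * d = n.+1%:R * d + d by rewrite -natr1; ring.
have -> : n%:R * d = n.+1%:R * d - d by rewrite -[n.+1%:R]natr1; ring.
rewrite sinhD sinhB; set S := sinh (_ * d) => A B.
have E : 2 * cosh d - (S * cosh d - cosh (n.+1%:R * d) * sinh d) / S =
  (S * cosh d + cosh (n.+1%:R * d) * sinh d) / S by field; rewrite gt_eqF.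
by rewrite E invf_div.
Qed.

(** A telescoping product of [k] steps. Starting at [j.+1] keeps the empty product equal to 1, since
    [0 / 0] is 0. *)
Lemma cm_mass_sinh_nat e (d : R -> R) j k : 0 < e ->
  (forall s, 0 < s -> 0 < d s /\ 2 * cosh (d s) = 2 + e * s) ->
  cm_mass (fun s => sinh (j.+1%:R * d s) / sinh ((j.+1 + k)%:R * d s))
    (j.+1%:R / (j.+1 + k)%:R).
Proof.
move=> e0 de; elim: k => [|k IH].
  rewrite addn0 divff ?pnatr_eq0//; apply: eq_cm_mass (cm_mass_cst ler01) => s s0.
  rewrite divff// gt_eqF// sinh_gt0// mulr_gt0 ?ltr0n//.
  by case: (de s s0).
rewrite addnS.
have -> : j.+1%:R / (j.+1 + k).+1%:R =
  (j.+1%:R / (j.+1 + k)%:R) * ((j.+1 + k)%:R / (j.+1 + k).+1%:R) :> R.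
  by rewrite mulrA divfK// pnatr_eq0 addSn.
apply: eq_cm_mass (cm_massM IH (cm_mass_sinh_step (j.+1 + k) e0)) => s s0.
have [d0 des] := de s s0.
rewrite (sinh_stepE _ d0 des) mulrA divfK// gt_eqF// sinh_gt0// mulr_gt0//.
Qed.

Definition sinh_ratio c a s := sinh (c * Num.sqrt s) / sinh (a * Num.sqrt s).

(* [sinh (c z) / sinh (a z)] is the limit of ratios of Chebyshev polynomials, i.e.
   of discrete Dirichlet problems on a grid of [n] points. *)
Lemma cm_mass_sinh_ratio c a : 0 < c -> c < a ->
  cm_mass (sinh_ratio c a) (c / a).
Proof.
move=> c0 ca; have a0 : 0 < a by exact: lt_trans ca.
(* Mesh width [a / n.+1]. Since [cosh (2 x) = 1 + 2 sinh x ^+ 2], this [d] solves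
   [2 cosh d = 2 + e s] exactly, and [n.+1 * d] tends to [a sqrt s]. *)
pose d n s := 2 * asinh ((a * Num.sqrt s / 2) / n.+1%:R).
pose e n : R := a ^+ 2 / n.+1%:R ^+ 2.
have dP n s : 0 < s -> 0 < d n s /\ 2 * cosh (d n s) = 2 + e n * s.
  move=> s0; set y := (a * Num.sqrt s / 2) / n.+1%:R.
  have y0 : 0 < y by rewrite !divr_gt0// ?ltr0n// mulr_gt0// sqrtr_gt0.
  split; first by rewrite mulr_gt0// (lt_le_trans _ (asinh_ge (ltW y0)))// divr_gt0//; lra.
  rewrite cosh2 asinhK// /y /e -[in RHS](sqr_sqrtr (ltW s0)); field.
  by have := ler0n R n; rewrite gt_eqF//; lra.
(* Index of the last grid point not beyond [c]. *)
pose j n := Num.truncn (n.+1%:R * (c / a)).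
have jP n : (j n)%:R <= n.+1%:R * (c / a) < (j n).+1%:R.
  by apply: Num.Theory.truncn_itv; rewrite mulr_ge0// divr_ge0// ltW.
have jn n : (j n <= n.+1)%N.
  rewrite -(ler_nat R); have /andP[/le_trans-> //] := jP n.
  by rewrite ler_piMr// ler_pdivrMr// mul1r ltW.
have cj : (j n)%:R / n.+1%:R @[n --> \oo] --> c / a.
  have c1 : c / a - n.+1%:R^-1 @[n --> \oo] --> c / a.
    suff : c / a - n.+1%:R^-1 @[n --> \oo] --> c / a - 0 by rewrite subr0.
    by apply: cvgB; [exact: cvg_cst|exact: cvg_harmonic].
  apply: squeeze_cvgr c1 (cvg_cst (c / a)); apply: nearW => n.
  have n0 : 0 < n.+1%:R :> R by rewrite ltr0n.
  have /andP[j1 j2] := jP n.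
  rewrite ler_pdivlMr// ler_pdivrMr// mulrBl mulVf ?gt_eqF// [_ * n.+1%:R]mulrC j1 andbT.
  by rewrite lerBlDr natr1 ltW.
have cd s : 0 < s -> n.+1%:R * d n s @[n --> \oo] --> a * Num.sqrt s.
  move=> s0; have y0 : 0 <= a * Num.sqrt s / 2 by rewrite divr_ge0// mulr_ge0// ltW.
  rewrite [X in _ --> X](_ : _ = 2 * (a * Num.sqrt s / 2)); last lra.
  under eq_cvg do rewrite /d mulrCA.
  by apply: cvgM; [exact: cvg_cst|exact: cvg_asinh].
apply: (@cm_mass_lim _ (fun n s => sinh ((j n)%:R * d n s) / sinh (n.+1%:R * d n s))
   (fun n => (j n)%:R / n.+1%:R)) => //.
  have ca0 : 0 < c / a by rewrite divr_gt0.
  have : \forall n \near \oo, 0 < (j n)%:R / n.+1%:R :> R by exact: cvgr_gt cj _ ca0.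
  apply: filterS => n jn0.
  have j0 : (0 < j n)%N.
    by rewrite lt0n; apply: contraTneq jn0 => ->; rewrite mul0r ltxx.
  have := @cm_mass_sinh_nat (e n) (d n) (j n).-1 (n.+1 - j n).
  by rewrite prednK// subnKC//; apply; [rewrite divr_gt0// exprn_gt0//|exact: dP].
move=> s s0; have sa : 0 < a * Num.sqrt s by rewrite mulr_gt0// sqrtr_gt0.
apply: cvgM; last first.
  apply: cvgV; first by rewrite gt_eqF// sinh_gt0.
  exact: (@continuous_cvg _ _ _ _ _ _ _ _ (@continuous_sinh R _) (cd s s0)).
apply: continuous_cvg; first exact: continuous_sinh.
rewrite [X in _ --> X](_ : _ = c / a * (a * Num.sqrt s)); last first.
  by rewrite mulrA divfK ?gt_eqF.
have e1 n : (j n)%:R * d n s = (j n)%:R / n.+1%:R * (n.+1%:R * d n s).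
  by rewrite [RHS]mulrA divfK// pnatr_eq0.
under eq_cvg do rewrite e1.
by apply: cvgM => //; exact: cd.
Qed.

(** The half-line as a limit of intervals of length [n], evaluated at distance [c] from the far end;
    the masses [(n - c) / n] tend to 1. *)
Lemma cm_mass_expR_sqrt c : 0 < c -> cm_mass (fun s => expR (- (c * Num.sqrt s))) 1.
Proof.
move=> c0.
apply: (@cm_mass_lim _ (fun n => sinh_ratio (n%:R - c) n%:R)
   (fun n => (n%:R - c) / n%:R)).
- have : \forall n \near \oo, c < n%:R by exact: nbhs_infty_gtr.
  by apply: filterS => n cn; apply: cm_mass_sinh_ratio; lra.
- move=> s s0; set z := Num.sqrt s; have z0 : 0 < z by rewrite sqrtr_gt0.
  have q1 : `|expR (- (2 * z))| < 1.
    by rewrite ger0_norm ?expR_ge0// expR_lt1; lra.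
  have q0 := cvg_expr q1.
  (* The ratio of hyperbolic sines after division of both terms by [expR (n z)]. *)
  have : (expR (- (c * z)) - expR (c * z) * expR (- (2 * z)) ^+ n) /
      (1 - expR (- (2 * z)) ^+ n) @[n --> \oo] --> expR (- (c * z)).
    suff : (expR (- (c * z)) - expR (c * z) * expR (- (2 * z)) ^+ n) /
        (1 - expR (- (2 * z)) ^+ n) @[n --> \oo] -->
        (expR (- (c * z)) - expR (c * z) * 0) / (1 - 0).
      by rewrite mulr0 !subr0 divr1.
    apply: cvgM; last first.
      apply: cvgV; first by rewrite subr0 oner_eq0.
      by apply: cvgB => //; exact: cvg_cst.
    apply: cvgB; first exact: cvg_cst.
    by apply: cvgM => //; exact: cvg_cst.
  apply: cvg_trans; apply: near_eq_cvg; near=> n.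
  have n0 : 0 < n%:R :> R by near: n; exact: nbhs_infty_gtr.
  have e1 : expR (- (2 * z)) ^+ n = expR (- (n%:R * z)) ^+ 2.
    by rewrite -!expRM_natl; congr expR; ring.
  have e2 : expR (- (n%:R * z)) = (expR (n%:R * z))^-1 by rewrite expRN.
  have n1 : 1 < expR (n%:R * z) by rewrite expR_gt1 mulr_gt0.
  rewrite /sinh_ratio -/z /sinh e1 [(n%:R - c) * z]mulrBl opprB [c * z - _]addrC !expRD e2 (expRN (c * z)).
  by field; rewrite !gt_eqF ?expR_gt0//; nra.
- suff : 1 - c * n%:R^-1 @[n --> \oo] --> 1 - c * 0.
    rewrite mulr0 subr0 => h; apply: cvg_trans h; apply: near_eq_cvg; near=> n.
    have n0 : 0 < n%:R :> R by near: n; exact: nbhs_infty_gtr.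
    by rewrite mulrBl divff// gt_eqF.
  apply: cvgB; first exact: cvg_cst.
  apply: cvgM; first exact: cvg_cst.
  by rewrite -(cvg_shiftS (fun n => n%:R^-1 : R)); exact: cvg_harmonic.
Unshelve. all: by end_near. Qed.

End sinh_ratio.

(** * Positivity from the Laplace transform *)

Section bernstein.
Variable R : realType.
Implicit Types (p q : nat -> R) (x y : R).

(** The mean of [p] under the binomial law with [n] trials of success probability [x], conditioned
    on one trial. No binomial coefficients appear, and [x = expR (- t)] turns the two summands into
    a shift and a difference of the transform. *)
Fixpoint bernstein n p x : R :=
  if n is n'.+1 then
    x * bernstein n' (fun j => p j.+1) x + (1 - x) * bernstein n' p x
  else p 0%N.

Lemma bernstein_ler n p q x : 0 <= x <= 1 -> (forall j, p j <= q j) ->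
  bernstein n p x <= bernstein n q x.
Proof.
move=> /andP[x0 x1]; elim: n p q => [|n IH] p q pq //=.
by rewrite lerD// ler_wpM2l ?subr_ge0// IH.
Qed.

Lemma bernsteinD n p q x :
  bernstein n (fun j => p j + q j) x = bernstein n p x + bernstein n q x.
Proof. by elim: n p q => [|n IH] p q //=; rewrite !IH; ring. Qed.

Lemma bernsteinZ n y p x : bernstein n (fun j => y * p j) x = y * bernstein n p x.
Proof. by elim: n p => [|n IH] p //=; rewrite !IH; ring. Qed.

Lemma bernstein_cst n y x : bernstein n (fun=> y) x = y.
Proof. by elim: n => [|n IH] //=; rewrite !IH; ring. Qed.

(** Bias squared plus binomial variance. The centre [y] is arbitrary because the recursion moves it
    to [y - 1]. *)
Lemma bernstein_sqr n x y : bernstein n (fun j => (j%:R - y) ^+ 2) x =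
  (n%:R * x - y) ^+ 2 + n%:R * x * (1 - x).
Proof.
elim: n y => [|n IH] y /=; first by ring.
have -> : (fun j => (j.+1%:R - y) ^+ 2) = (fun j => (j%:R - (y - 1)) ^+ 2).
  by apply/funext => j; rewrite -natr1; congr (_ ^+ _); ring.
by rewrite !IH -natr1; ring.
Qed.

(** Chebyshev's inequality: the two indicators can differ only where [j / n.+1] is at distance at
    least [e] from [x], and there [1 <= w j]; the mean of [w] is of order [1 / n]. *)
Lemma cvg_bernstein_indic (A : set R) x e : 0 <= x <= 1 -> 0 < e ->
  (forall y, `|y - x| < e -> \1_A y = \1_A x :> R) ->
  bernstein n.+1 (fun j => \1_A (j%:R / n.+1%:R)) x @[n --> \oo] --> (\1_A x : R).
Proof.
move=> x01 e0 Ax; have /andP[x0 x1] := x01.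
have h n : `|\1_A x - bernstein n.+1 (fun j => \1_A (j%:R / n.+1%:R)) x| <=
    (e ^- 2 * (x * (1 - x))) * n.+1%:R^-1.
  have n0 : 0 < n.+1%:R :> R by rewrite ltr0n.
  pose w j := (e * n.+1%:R) ^- 2 * (j%:R - n.+1%:R * x) ^+ 2.
  have wE : bernstein n.+1 w x = (e ^- 2 * (x * (1 - x))) * n.+1%:R^-1.
    rewrite /w bernsteinZ bernstein_sqr subrr expr0n add0r.
    by field; rewrite !gt_eqF.
  have w0 j : 0 <= w j by rewrite mulr_ge0 ?sqr_ge0// invr_ge0 sqr_ge0.
  have key j : `|\1_A (j%:R / n.+1%:R) - \1_A x| <= w j.
    have [/Ax ->|xe] := ltP `|j%:R / n.+1%:R - x| e; first by rewrite subrr normr0.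
    apply: (@le_trans _ _ 1).
      by rewrite !indicE; do 2 case: (_ \in _); rewrite ?subrr ?subr0 ?sub0r ?normrN ?normr0 ?normr1.
    rewrite /w mulrC ler_pdivlMr ?exprn_gt0// ?mulr_gt0// mul1r.
    rewrite -[leRHS]real_normK ?num_real//.
    rewrite ler_pXn2r ?nnegrE//; last by rewrite mulr_ge0// ltW.
    have -> : j%:R - n.+1%:R * x = (j%:R / n.+1%:R - x) * n.+1%:R.
      by rewrite mulrBl divfK ?gt_eqF// [x * _]mulrC.
    by rewrite normrM (ger0_norm (ltW n0)) ler_wpM2r// ltW.
  rewrite -wE distrC ler_norml; apply/andP; split.
    rewrite lerBrDl -[X in X + _](bernstein_cst n.+1 _ x) -[- _]mulN1r -bernsteinZ -bernsteinD.
    apply: bernstein_ler => // j; have := key j; rewrite ler_norml; lra.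
  rewrite lerBlDl -[X in X + _](bernstein_cst n.+1 _ x) -bernsteinD.
  by apply: bernstein_ler => // j; have := key j; rewrite ler_norml; lra.
apply/cvgrPdist_le => eps eps0.
set c := e ^- 2 * (x * (1 - x)) in h.
have /cvgrPdist_le/(_ eps eps0) : c * n.+1%:R^-1 @[n --> \oo] --> c * (0 : R).
  by apply: cvgM; [exact: cvg_cst|exact: cvg_harmonic].
apply: filterS => n; rewrite mulr0 sub0r normrN => h1.
by apply: le_trans (h n) _; apply: le_trans h1; exact: ler_norm.
Qed.

End bernstein.

(** * Laplace transforms on the real axis and the moment argument *)

Section laplace_transform.
Variable R : realType.
Notation mu := (@lebesgue_measure R).
Notation Rp := (`]0%R, +oo[%classic : set R).
Implicit Types (f g : R -> R) (s : R).

Definition has_laplace f := measurable_fun Rp f /\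
  forall s, 0 < s -> mu.-integrable Rp (EFin \o (fun t => expR (- (s * t)) * f t)).

Definition rlaplace f s : R := \int[mu]_(t in Rp) (expR (- (s * t)) * f t).

Lemma measurable_Rp : measurable (Rp : set (measurableTypeR R)).
Proof. exact: measurable_itv. Qed.
Local Hint Resolve measurable_Rp : core.

Lemma measurable_expRN s : measurable_fun setT (fun t : R => expR (- (s * t))).
Proof.
by apply: measurableT_comp => //; apply: measurableT_comp.
Qed.

Lemma has_laplace_bounded f g (M : R) : has_laplace f -> measurable_fun Rp g ->
  (forall t, 0 < t -> `|g t| <= M * `|f t|) -> has_laplace g.
Proof.
move=> [mf If] mg gf; split => // s s0.
apply: (le_integrable measurable_Rp _ _ (integrableZl measurable_Rp M (If s s0))).
  apply/measurable_EFinP; apply: measurable_funM => //.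
  exact: measurable_funS (measurable_expRN s).
move=> t /=; rewrite in_itv/= andbT => t0.
rewrite lee_fin !normrM [leRHS]mulrCA ler_wpM2l//.
by apply: le_trans (gf t t0) _; rewrite ler_wpM2r// ler_norm.
Qed.

Lemma has_laplaceM f g (M : R) : has_laplace f -> measurable_fun Rp g ->
  (forall t, 0 < t -> `|g t| <= M) -> has_laplace (fun t => g t * f t).
Proof.
move=> hf mg gM; apply: (@has_laplace_bounded f _ M) => //.
  by apply: measurable_funM => //; case: hf.
by move=> t t0; rewrite normrM ler_wpM2r// gM.
Qed.

Lemma has_laplaceZ (c : R) f : has_laplace f -> has_laplace (fun t => c * f t).
Proof.
by move=> hf; exact: (@has_laplaceM f (cst c) `|c| hf).
Qed.

Lemma has_laplaceD f g : has_laplace f -> has_laplace g ->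
  has_laplace (fun t => f t + g t).
Proof.
move=> [mf If] [mg Ig]; split; first exact: measurable_funD.
move=> s s0; apply: (eq_integrable measurable_Rp _ _ _ (integrableD measurable_Rp (If s s0) (Ig s s0))).
by move=> t _ /=; rewrite mulrDr EFinD.
Qed.

Lemma rlaplaceZ (c : R) f s : has_laplace f -> 0 < s ->
  rlaplace (fun t => c * f t) s = c * rlaplace f s.
Proof.
move=> [mf If] s0; rewrite -RintegralZl//; last exact: If.
by apply: eq_Rintegral => t _; rewrite mulrCA.
Qed.

Lemma rlaplaceD f g s : has_laplace f -> has_laplace g -> 0 < s ->
  rlaplace (fun t => f t + g t) s = rlaplace f s + rlaplace g s.
Proof.
move=> [mf If] [mg Ig] s0; rewrite -RintegralD//; [|exact: If|exact: Ig].
by apply: eq_Rintegral => t _; rewrite mulrDr.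
Qed.

Lemma rlaplace_shift f s :
  rlaplace f (s + 1) = rlaplace (fun t => expR (- t) * f t) s.
Proof.
by apply: eq_Rintegral => t _; rewrite mulrA -expRD; congr (expR _ * _); ring.
Qed.

Lemma rlaplace_fdiff f s : has_laplace f -> 0 < s ->
  fdiff (rlaplace f) s = rlaplace (fun t => (1 - expR (- t)) * f t) s.
Proof.
move=> hf s0; have [mf If] := hf.
rewrite /fdiff /rlaplace -RintegralB//; last 2 first.
- exact: If.
- by apply: If; rewrite addr_gt0.
apply: eq_Rintegral => t _.
by rewrite mulrBl mul1r mulrBr mulrA -expRD; congr (_ - expR _ * _); ring.
Qed.

Lemma measurable_expRN1 : measurable_fun Rp (fun t : R => expR (- t)).
Proof. by apply: measurable_funTS; apply: measurableT_comp. Qed.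

Lemma has_laplace_expRN f : has_laplace f -> has_laplace (fun t => expR (- t) * f t).
Proof.
move=> hf; apply: (has_laplaceM (M := 1) hf measurable_expRN1) => t t0.
by rewrite ger0_norm ?expR_ge0// expR_le1 oppr_le0 ltW.
Qed.

Lemma has_laplace_1BexpRN f :
  has_laplace f -> has_laplace (fun t => (1 - expR (- t)) * f t).
Proof.
move=> hf; apply: (has_laplaceM (M := 1) hf).
  by apply: measurable_funB => //; exact: measurable_expRN1.
move=> t t0; have := expR_ge0 (- t).
have : expR (- t) <= 1 by rewrite expR_le1 oppr_le0 ltW.
by move=> e1 e0; rewrite ger0_norm; lra.
Qed.

Definition cm_laplace f := has_laplace f /\ cm (rlaplace f).

(** Multiplying [f] by [expR (- t)] shifts its transform, multiplying by [1 - expR (- t)] takes its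
    difference; both preserve [cm]. *)
Lemma cm_laplace_bernstein f n p : (forall j, 0 <= p j) -> cm_laplace f ->
  cm_laplace (fun t => bernstein n p (expR (- t)) * f t).
Proof.
elim: n p => [|n IH] p p0 [hf cf] /=.
  split; first exact: has_laplaceZ.
  by apply: eq_cm (cmZ (p0 0%N) cf) => s s0; rewrite rlaplaceZ.
have [hg cg] := IH _ (fun j => p0 j.+1) (conj hf cf).
have [hk ck] := IH _ p0 (conj hf cf).
have [h1 h2] := (has_laplace_expRN hg, has_laplace_1BexpRN hk).
have e : (fun t => (expR (- t) * bernstein n (fun j => p j.+1) (expR (- t)) +
   (1 - expR (- t)) * bernstein n p (expR (- t))) * f t) =
  (fun t => expR (- t) * (bernstein n (fun j => p j.+1) (expR (- t)) * f t) +
   (1 - expR (- t)) * (bernstein n p (expR (- t)) * f t)).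
  by apply/funext => t; ring.
rewrite e; split; first exact: has_laplaceD.
apply: eq_cm (cmD (fun k => cmn_shift (cg k)) (fun k => (ck k.+1).2)) => s s0.
by rewrite rlaplace_shift rlaplace_fdiff// -rlaplaceD.
Qed.

Lemma bernstein_ge0 n p (x : R) : 0 <= x <= 1 -> (forall j, 0 <= p j) ->
  0 <= bernstein n p x.
Proof. by move=> x01 p0; rewrite -[leLHS](bernstein_cst n _ x); exact: bernstein_ler. Qed.

(** In the variable [expR (- t)] the ball is the interval [A], whose indicator is approximated by
    Bernstein polynomials with values in [0, 1]. The weight [expR (- t)] comes from evaluating
    transforms at [s = 1] and gives the integrable dominating function. *)
Lemma cm_laplace_ball f x r : 0 < r -> cm_laplace f ->
  (0 <= \int[mu]_(t in Rp) (\1_(ball x r) t * (expR (- t) * f t))%:E)%E.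
Proof.
move=> r0 cf; have [hf _] := cf; have [mf If] := hf.
have I1 : mu.-integrable Rp (EFin \o (fun t => expR (- t) * f t)).
  by apply: (eq_integrable measurable_Rp _ _ _ (If 1 ltr01)) => t _ /=; rewrite mul1r.
pose A : set R := `]expR (- (x + r)), expR (- (x - r))[%classic.
pose p n j : R := \1_A (j%:R / n.+1%:R).
pose F n t := bernstein n.+1 (p n) (expR (- t)).
have cF n : cm_laplace (fun t => F n t * f t).
  by apply: cm_laplace_bernstein => // j; rewrite /p indicE; case: (_ \in _).
have F01 n t : 0 < t -> 0 <= F n t <= 1.
  move=> t0; have e01 : 0 <= expR (- t) <= 1.
    by rewrite expR_ge0/= expR_le1 oppr_le0 ltW.
  apply/andP; split.
    by apply: bernstein_ge0 => // j; rewrite /p indicE; case: (_ \in _).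
  rewrite -[leRHS](bernstein_cst n.+1 _ (expR (- t))); apply: bernstein_ler => // j.
  by rewrite /p indicE; case: (_ \in _).
have AE t : A (expR (- t)) <-> ball x r t.
  rewrite /A /= in_itv/= !ltr_expR ball_itv/= in_itv/=.
  by split => /andP[? ?]; apply/andP; split; lra.
have [|||||_ _ cv] := @dominated_convergence _ _ R mu Rp measurable_Rp
  (fun n t => (F n t * (expR (- t) * f t))%:E)
  (fun t => (\1_(ball x r) t * (expR (- t) * f t))%:E)
  (fun t => `|expR (- t) * f t|%:E).
- move=> n; have [[_ /(_ 1 ltr01)/measurable_int h] _] := cF n.
  apply: (eq_measurable_fun (EFin \o (fun t => expR (- (1 * t)) * (F n t * f t)))) => //.
  by move=> t _ /=; rewrite mul1r mulrCA.
- apply/measurable_EFinP; apply: measurable_funM; last exact/measurable_EFinP/measurable_int/I1.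
  by apply: measurable_indic; exact: measurable_ball.
(* Convergence may fail only where [expR (- t)] is an end point of [A]. *)
- exists [set x + r; x - r]; split.
  + by apply: measurableU; exact: measurable_set1.
  + rewrite measureU0//; [exact: lebesgue_measure_set1|exact: lebesgue_measure_set1].
  move=> t; apply: contra_notP => /= tN; move=> Rt.
  have [t1 t2] : t != x + r /\ t != x - r.
    by split; apply/eqP => tE; apply: tN; [left|right].
  apply: cvg_EFin; first exact: nearW.
  apply: cvgM; last exact: cvg_cst.
  have -> : \1_(ball x r) t = \1_A (expR (- t)) :> R.
    by rewrite !indicE; congr ((_ : bool)%:R); apply/idP/idP; rewrite !inE => /AE.
  have t0 : 0 < t by move: Rt; rewrite /= in_itv/= andbT.
  pose e := Num.min `|expR (- t) - expR (- (x + r))| `|expR (- t) - expR (- (x - r))|.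
  apply: (@cvg_bernstein_indic _ A (expR (- t)) e).
  + by rewrite expR_ge0/= expR_le1 oppr_le0 ltW.
  + rewrite /e lt_min !normr_gt0 !subr_eq0.
    by apply/andP; split; apply/eqP => /expR_inj/oppr_inj/eqP; apply/negP.
  move=> y; rewrite /e lt_min => /andP[y1 y2]; rewrite !indicE; congr ((_ : bool)%:R).
  (* Squared distances leave polynomial inequalities, which [nra] can combine with the order of the
     end points. *)
  have {}y1 : (y - expR (- t)) ^+ 2 < (expR (- t) - expR (- (x + r))) ^+ 2.
    by rewrite -[ltLHS]real_normK ?num_real// -[ltRHS]real_normK ?num_real// ltr_pXn2r ?nnegrE.
  have {}y2 : (y - expR (- t)) ^+ 2 < (expR (- t) - expR (- (x - r))) ^+ 2.
    by rewrite -[ltLHS]real_normK ?num_real// -[ltRHS]real_normK ?num_real// ltr_pXn2r ?nnegrE.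
  have : expR (- (x + r)) < expR (- (x - r)) by rewrite ltr_expR; lra.
  move: y1 y2; set u := expR (- (x + r)); set v := expR (- (x - r)); set z := expR (- t).
  move=> y1 y2 uv; rewrite /A -/u -/v.
  apply/idP/idP; rewrite !inE /= !in_itv/= => /andP[? ?]; apply/andP; split; nra.
- exact: integrable_norm I1.
- apply: aeW => t n /=; rewrite in_itv/= andbT => t0; rewrite lee_fin normrM.
  by have /andP[F0 F1] := F01 n t t0; rewrite (ger0_norm F0) ler_piMl.
rewrite -(cvg_lim _ cv)//; apply: lime_ge; first exact: cvgP cv.
apply: nearW => n.
have [[_ /(_ 1 ltr01) In] /cm_ge0/(_ ltr01)] := cF n.
rewrite /rlaplace /Rintegral -lee_fin fineK; last exact: (integrable_fin_num measurable_Rp In).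
by congr (_ <= _)%E; apply: eq_integral => t _; rewrite mul1r mulrCA.
Qed.

(** At a Lebesgue point of [expR (- t) * f t] the value is a limit of nonnegative averages over
    balls. *)
Lemma cm_laplace_ge0 f : cm_laplace f -> {ae mu, forall t, Rp t -> 0 <= f t}.
Proof.
move=> cf; have [[mf If] _] := cf.
have I1 : mu.-integrable Rp (EFin \o (fun t => expR (- t) * f t)).
  by apply: (eq_integrable measurable_Rp _ _ _ (If 1 ltr01)) => t _ /=; rewrite mul1r.
have lg := integrable_locally measurable_Rp I1.
pose E (x : R) n := ball x n.+1%:R^-1.
have hE x : nicely_shrinking x (E x).
  split; first by move=> n; exact: measurable_ball.
  exists (1, fun n => (n.+1%:R^-1)%:pos); split => //=.
  - exact: cvg_harmonic.
  - by move=> n; exact: subset_refl.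
  - by move=> n; rewrite mul1e.
have := lebesgue_differentiation lg.
apply: filterS; first exact: (ae_filter_ringOfSetsType mu).
move=> x lx Rx.
have cv := nice_lebesgue_differentiation hE lg lx.
have : (0 <= (((fun t => expR (- t) * f t) \_ Rp) x)%:E)%E.
  rewrite -(cvg_lim _ cv)//; apply: lime_ge; first exact: cvgP cv.
  apply: nearW => n; apply: mule_ge0.
    by rewrite inve_ge0.
  have := @cm_laplace_ball f x n.+1%:R^-1 _ cf.
  rewrite invr_gt0 ltr0n => /(_ isT).
  rewrite integral_mkcond [in X in _ -> X]integral_mkcond.
  congr (_ <= _)%E; apply: eq_integral => t _.
  rewrite /E !patchE indicE.
  by do 2 case: (t \in _); rewrite ?mul1r ?mul0r.
by rewrite patchE mem_set// lee_fin pmulr_rge0// expR_gt0.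
Qed.

End laplace_transform.

(** * The complementary error function *)

Section erfc.
Variable R : realType.
Notation mu := (@lebesgue_measure R).
Implicit Types x y : R.

Lemma integrable_gauss (A : set R) : measurable (A : set (measurableTypeR R)) ->
  mu.-integrable A (EFin \o gauss_fun).
Proof. by move=> mA; apply: integrableS (@integrableT_gauss R). Qed.

(** Moves the variable to the upper limit of integration, where the fundamental theorem of calculus
    applies. *)
Lemma erfcE x : erfc x = 2 / Num.sqrt pi *
  (Num.sqrt pi - \int[mu]_(t in `]-oo, x]) gauss_fun t).
Proof.
rewrite /erfc; congr (_ * _).
rewrite -(@Rintegral_itvB _ _ -oo%O +oo%O)//; last by rewrite set_itvNyy; exact: integrable_gauss.
by rewrite set_itvNyy /Rintegral integralT_gauss.
Qed.

Lemma is_derive_erfc x : is_derive x 1 (@erfc R) (- (2 / Num.sqrt pi) * expR (- x ^+ 2)).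
Proof.
have x1 : x < x + 1 by rewrite ltrDl.
have [dF F'] := @continuous_FTC1 R gauss_fun -oo%O x (x + 1) x1
  (integrable_gauss (measurable_itv _)) (ltNyr _) (@continuous_gauss_fun R x).
pose F y : R := \int[mu]_(t in [set` Interval -oo%O (BRight y)]) gauss_fun t.
have iF : is_derive x 1 F (gauss_fun x).
  by rewrite -F' derive1E; exact: derivableP.
have -> : @erfc R = (2 / Num.sqrt pi) \*: (cst (Num.sqrt pi) - F).
  by apply/funext => y; rewrite erfcE.
apply: is_derive_eq; rewrite sub0r scalerN mulNr //.
Qed.

Lemma erfc_ge0 x : 0 <= erfc x.
Proof.
rewrite mulr_ge0 ?divr_ge0 ?sqrtr_ge0//.
by apply: Rintegral_ge0 => t _; exact: expR_ge0.
Qed.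

Lemma continuous_erfc : continuous (@erfc R).
Proof.
move=> x; apply/differentiable_continuous/derivable1_diffP.
by have [] := is_derive_erfc x.
Qed.

Lemma erfc_noninc x y : x <= y -> erfc y <= erfc x.
Proof.
move=> xy; rewrite /erfc ler_wpM2l ?divr_ge0 ?sqrtr_ge0//.
rewrite fine_le//.
- exact/integrable_fin_num/integrable_gauss.
- exact/integrable_fin_num/integrable_gauss.
apply: ge0_subset_integral => //.
- by apply/measurable_EFinP/measurable_funTS; exact: measurable_gauss_fun.
- by apply: subset_itvr; rewrite bnd_simp.
Qed.

Lemma erfc0 : @erfc R 0 = 1.
Proof.
rewrite /erfc Rintegral_itv_obnd_cbnd; last exact: integrable_gauss.
have spi : 0 < Num.sqrt pi :> R by rewrite sqrtr_gt0 pi_gt0.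
by rewrite /Rintegral integral0y_gauss /=; field; rewrite gt_eqF.
Qed.

Lemma erfcN x : erfc (- x) = 2 - erfc x.
Proof.
have h y : (@erfc R + (@erfc R \o -%R)) y = 2.
  transitivity ((@erfc R + (@erfc R \o -%R)) 0).
    apply: is_derive_0_is_cst => {}y.
    have d1 := is_derive_erfc y; have d2 := is_derive_erfc (- y).
    apply: is_derive_eq.
    rewrite sqrrN; ring.
  by change (erfc 0 + erfc (- 0) = 2 :> R); rewrite oppr0 erfc0; lra.
by have : erfc x + erfc (- x) = 2 := h x; lra.
Qed.

(** The limit is taken along the integers, over growing intervals; monotonicity fills the gaps. *)
Lemma cvg_erfc_pinfty : @erfc R x @[x --> +oo] --> (0 : R).
Proof.
have spi : 0 < Num.sqrt pi :> R by rewrite sqrtr_gt0 pi_gt0.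
pose I (n : nat) : R := \int[mu]_(t in `[0, n%:R]) gauss_fun t.
have cI : I n @[n --> \oo] --> (Num.sqrt pi / 2 : R).
  apply: fine_cvg; rewrite -integral0y_gauss.
  exact: (ge0_cvgn_integral gauss_fun_ge0 measurable_gauss_fun).
have eI n : erfc n%:R = 2 / Num.sqrt pi * (Num.sqrt pi / 2 - I n).
  rewrite /erfc; congr (_ * _).
  rewrite -(@Rintegral_itvB _ _ (BLeft 0) +oo%O)//; last 2 first.
  - exact: (integrable_gauss (measurable_itv _)).
  - by rewrite bnd_simp.
  by rewrite /Rintegral integral0y_gauss.
have ce : erfc n%:R @[n --> \oo] --> (0 : R).
  rewrite [X in _ --> X](_ : _ = 2 / Num.sqrt pi * (Num.sqrt pi / 2 - Num.sqrt pi / 2)); last first.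
    by rewrite subrr mulr0.
  under eq_cvg do rewrite eI.
  by apply: cvgM; [exact: cvg_cst|apply: cvgB => //; exact: cvg_cst].
apply/cvgrPdist_le => e e0.
have /cvgrPdist_le/(_ e e0) [N _ /(_ N (leqnn N))] := ce.
rewrite /= sub0r normrN ger0_norm ?erfc_ge0// => eN.
exists N%:R; split; first exact: num_real.
move=> x Nx; rewrite sub0r normrN ger0_norm ?erfc_ge0//.
by apply: le_trans eN; exact/erfc_noninc/ltW.
Qed.

Lemma erfc_le2 x : erfc x <= 2.
Proof. by have := erfcN x; have := erfc_ge0 (- x); lra. Qed.

Lemma cvg_erfc_ninfty : @erfc R x @[x --> -oo] --> (2 : R).
Proof.
suff : (@erfc R \o -%R) x @[x --> +oo] --> (2 - 0 : R).
  by rewrite subr0 => h; exact/cvgNy_compNP.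
under eq_cvg do rewrite /= erfcN.
apply: cvgB; [exact: cvg_cst|exact: cvg_erfc_pinfty].
Qed.

End erfc.

(** * The Laplace transform of the complementary error function *)

Section laplace_erfc.
Variable R : realType.
Notation mu := (@lebesgue_measure R).
Notation Rp := (`]0%R, +oo[%classic : set R).
Implicit Types c s t T : R.

Lemma cvg_expRN_pinfty s : 0 < s -> expR (- (s * t)) @[t --> +oo] --> (0 : R).
Proof.
move=> s0; apply: (@cvg_comp _ _ _ (fun t => s * t) (fun t => expR (- t))).
  by apply: gt0_cvgMry => //; exact: cvg_id.
exact: cvgr_expR.
Qed.

Lemma is_derive_expRN s t : is_derive t 1 (fun t => expR (- (s * t))) (- s * expR (- (s * t))).
Proof.
have d : is_derive t 1 (fun t => - (s * t)) (- s).
  rewrite (_ : (fun t => - (s * t)) = (- s) \*: id); last first.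
    by apply/funext => x; change (- (s * x) = (- s) * x); rewrite mulNr.
  by apply: is_derive_eq; rewrite /GRing.scale /= mulr1.
have := @is_derive1_comp R expR (fun t => - (s * t)) t _ _ (is_derive_expR _) d.
by rewrite mulrC.
Qed.

Lemma integral_expRN s T : 0 < s ->
  (\int[mu]_(t in `[T, +oo[) (expR (- (s * t)))%:E = (expR (- (s * T)) / s)%:E)%E.
Proof.
move=> s0; pose F t := (- s^-1) * expR (- (s * t)).
have dF t : is_derive t 1 F (expR (- (s * t))).
  have h := is_derive_expRN s t.
  rewrite /F (_ : (fun t => _) = (- s^-1) \*: (fun t => expR (- (s * t)))) //.
  apply: is_derive_eq; change ((- s^-1) * (- s * expR (- (s * t))) = expR (- (s * t))).
  by field; rewrite gt_eqF.
rewrite (@ge0_continuous_FTC2y R _ F T 0).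
- have -> : (expR (- (s * T)) / s)%:E = (0 - F T)%:E by rewrite /F; congr (_%:E); ring.
  by rewrite EFinB.
- by move=> t _; exact: expR_ge0.
- apply: continuous_subspaceT => t.
  apply/differentiable_continuous/derivable1_diffP.
  by have [] := is_derive_expRN s t.
- rewrite -(mulr0 (- s^-1)); apply: cvgM; [exact: cvg_cst|exact: cvg_expRN_pinfty].
- by move=> t _; have [] := dF t.
- apply: cvg_at_right_filter; apply/differentiable_continuous/derivable1_diffP.
  by have [] := dF T.
- by move=> t _; rewrite derive1E; have [_ ->] := dF t.
Qed.

Lemma has_laplace_cst c : has_laplace (fun=> c).
Proof.
have h : has_laplace (fun=> 1 : R).
  split => // s s0.
  apply/integrableP; split.
    apply/measurable_EFinP; apply: measurable_funM => //.
    exact: measurable_funS (measurable_expRN s).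
  under eq_integral do rewrite /= mulr1 ger0_norm ?expR_ge0//.
  rewrite integral_itv_obnd_cbnd; last first.
    by apply/measurable_EFinP; exact: measurable_funS (measurable_expRN s).
  by rewrite integral_expRN// ltry.
have := has_laplaceZ c h.
by under [X in has_laplace X]funext do rewrite mulr1.
Qed.

Lemma rlaplace_cst c s : 0 < s -> rlaplace (fun=> c) s = c / s.
Proof.
move=> s0; have [_ /(_ s s0) I1] := has_laplace_cst 1.
rewrite -[c in LHS]mulr1 (rlaplaceZ c (has_laplace_cst 1) s0); congr (_ * _).
rewrite /rlaplace Rintegral_itv_obnd_cbnd //.
under eq_Rintegral do rewrite mulr1.
by rewrite /Rintegral integral_expRN//= mulr0 oppr0 expR0 div1r.
Qed.

Lemma has_laplace_indic T : has_laplace (\1_(`[T, +oo[%classic : set R)).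
Proof.
have -> : \1_(`[T, +oo[%classic : set R) = (fun t => \1_(`[T, +oo[%classic : set R) t * (1 : R)).
  by apply/funext => t; rewrite mulr1.
apply: (has_laplaceM (M := 1) (has_laplace_cst 1)).
  exact: measurable_indic.
by move=> t t0; rewrite indicE; case: (_ \in _); rewrite ?normr1 ?normr0.
Qed.

Lemma rlaplace_indic T s : 0 < T -> 0 < s ->
  rlaplace (\1_(`[T, +oo[%classic : set R)) s = expR (- (T * s)) / s.
Proof.
move=> T0 s0; set I := (`[T, +oo[%classic : set R).
have -> : rlaplace \1_I s = \int[mu]_(t in I) expR (- (s * t)).
  rewrite /rlaplace Rintegral_mkcond [RHS]Rintegral_mkcond.
  apply: eq_Rintegral => t _; rewrite !patchE indicE.
  have [Tt|tT] := leP T t.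
    rewrite !mem_set ?mulr1//; rewrite /I /= in_itv/= andbT//.
    exact: lt_le_trans Tt.
  by rewrite (@memNset _ I) ?mulr0 ?if_same// /I /= in_itv/= andbT; apply/negP; rewrite -ltNge.
by rewrite /Rintegral integral_expRN//= [s * T]mulrC.
Qed.

Lemma cvg_sqrt_pinfty : Num.sqrt t @[t --> +oo] --> (+oo : set_system R).
Proof.
apply/cvgryPge => A; near=> t.
apply: le_trans (ler_norm A) _; rewrite -sqrtr_sqr ler_sqrt; last first.
  by near: t; apply: nbhs_pinfty_ge; exact: num_real.
by near: t; apply: nbhs_pinfty_ge; exact: num_real.
Unshelve. all: by end_near. Qed.

Lemma cvg_sqrt_right0 : Num.sqrt t @[t --> (0 : R)^'+] --> (0 : R).
Proof.
by apply: cvg_at_right_filter; rewrite -[X in _ --> X]sqrtr0; exact: sqrt_continuous.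
Qed.

Lemma cvg_div_sqrt_right0 c : 0 < c ->
  c / (2 * Num.sqrt t) @[t --> (0 : R)^'+] --> (+oo : set_system R).
Proof.
move=> c0; apply: gt0_cvgMry => //; apply/cvgrVy.
  near=> t; have t0 : 0 < t by near: t; exact: nbhs_right_gt.
  by rewrite mulr_gt0// sqrtr_gt0.
rewrite -[X in _ --> X](mulr0 2); apply: cvgM; first exact: cvg_cst.
exact: cvg_sqrt_right0.
Unshelve. all: by end_near. Qed.

Lemma cvg_shift_sqrt_right0 c z : 0 < c ->
  c / (2 * Num.sqrt t) + z * Num.sqrt t @[t --> (0 : R)^'+] --> (+oo : set_system R).
Proof.
move=> c0; apply/cvgryPge => A.
have /cvgryPge/(_ (A + `|z|)) h := cvg_div_sqrt_right0 c0.
near=> t; have t0 : 0 < t by near: t; exact: nbhs_right_gt.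
have t1 : t <= 1 by near: t; exact: nbhs_right_le.
have r1 : Num.sqrt t <= 1 by rewrite -sqrtr1 ler_sqrt.
have r0 : 0 <= Num.sqrt t by exact: sqrtr_ge0.
have : - `|z| <= z * Num.sqrt t.
  have : `|z * Num.sqrt t| <= `|z| by rewrite normrM (ger0_norm r0) ler_piMr.
  by rewrite ler_norml => /andP[].
have : A + `|z| <= c / (2 * Num.sqrt t) by near: t.
lra.
Unshelve. all: by end_near. Qed.

(* Antiderivative in [t] of [expR (- s t) * erfc (c / (2 sqrt t))], where [z = sqrt s]. *)
Let primitive c z t :=
  (2 * z ^+ 2)^-1 * (expR (- (c * z)) * erfc (c / (2 * Num.sqrt t) + (- z) * Num.sqrt t)
     + expR (c * z) * erfc (c / (2 * Num.sqrt t) + z * Num.sqrt t))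
  - (z ^+ 2)^-1 * (expR (- (z ^+ 2 * t)) * erfc (c / (2 * Num.sqrt t))).

Lemma is_derive_shift_sqrt c z t : 0 < t ->
  is_derive t 1 (fun t => c / (2 * Num.sqrt t) + z * Num.sqrt t)
    (- c / (4 * t * Num.sqrt t) + z / (2 * Num.sqrt t)).
Proof.
move=> t0; have r0 : 0 < Num.sqrt t by rewrite sqrtr_gt0.
have d1 := is_derive1_sqrt t0.
have d2 : is_derive t 1 (fun t => (Num.sqrt t)^-1) _ := is_deriveV (lt0r_neq0 r0) d1.
have d3 : is_derive t 1 ((c / 2) \*: (fun t => (Num.sqrt t)^-1) + z \*: Num.sqrt) _ := is_deriveD (is_deriveZ _ d2) (is_deriveZ _ d1).
rewrite (_ : (fun t => _) = ((c / 2) \*: (fun t => (Num.sqrt t)^-1) + z \*: Num.sqrt)); last first.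
  apply/funext => x; change (c / (2 * Num.sqrt x) + z * Num.sqrt x = c / 2 * (Num.sqrt x)^-1 + z * Num.sqrt x).
  by rewrite invfM mulrA.
apply: is_derive_eq; rewrite /GRing.scale /=.
move: (sqr_sqrtr (ltW t0)) r0; set r := Num.sqrt t => e r0.
rewrite -[X in 4 * X]e; by field; rewrite gt_eqF.
Qed.

Lemma is_derive_erfc_comp (f : R -> R) t df : is_derive t 1 f df ->
  is_derive t 1 (fun t => erfc (f t)) (- (2 / Num.sqrt pi) * expR (- f t ^+ 2) * df).
Proof. by move=> d; exact: (is_derive1_comp (is_derive_erfc (f t)) d). Qed.

Lemma is_derive_primitive c z t : 0 < z -> 0 < t ->
  is_derive t 1 (primitive c z) (expR (- (z ^+ 2 * t)) * erfc (c / (2 * Num.sqrt t))).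
Proof.
move=> z0 t0; have r0 : 0 < Num.sqrt t by rewrite sqrtr_gt0.
have d1 := is_derive_erfc_comp (is_derive_shift_sqrt c (- z) t0).
have d2 := is_derive_erfc_comp (is_derive_shift_sqrt c z t0).
have d3 := is_derive_erfc_comp (is_derive_shift_sqrt c 0 t0).
have e3 : (fun t => erfc (c / (2 * Num.sqrt t) + 0 * Num.sqrt t)) =
    (fun t => erfc (c / (2 * Num.sqrt t))) :> (R -> R).
  by apply/funext => x; rewrite mul0r addr0.
rewrite e3 in d3.
have d4 := is_derive_expRN (z ^+ 2) t.
have d := is_deriveB (is_deriveZ ((2 * z ^+ 2)^-1)
  (is_deriveD (is_deriveZ (expR (- (c * z))) d1) (is_deriveZ (expR (c * z)) d2)))
  (is_deriveZ (z ^+ 2)^-1 (is_deriveM d4 d3)).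
apply: (is_derive_eq d).
rewrite /GRing.scale /=.
move: (sqr_sqrtr (ltW t0)) r0; set r := Num.sqrt t => e r0.
set K := 2 / _; set u := c / (2 * r).
have cu : 2 * u * r = c by rewrite /u; field; rewrite gt_eqF.
(* Completing the square with [c z = 2 u z r] reduces all three Gaussian factors to [X]; their
   contributions then cancel, leaving the derivative of [expR (- (z ^+ 2 * t))]. *)
pose X := expR (- u ^+ 2 - z ^+ 2 * t).
have E1 : expR (- (c * z)) * expR (- (u + - z * r) ^+ 2) = X.
  by rewrite -expRD /X -e -[in LHS]cu; congr expR; ring.
have E2 : expR (c * z) * expR (- (u + z * r) ^+ 2) = X.
  by rewrite -expRD /X -e -[in LHS]cu; congr expR; ring.
have E3 : expR (- (z ^+ 2 * t)) * expR (- (u + 0 * r) ^+ 2) = X.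
  by rewrite -expRD /X; congr expR; ring.
have E A B C : A * (- K * B * C) = - K * (A * B) * C by ring.
by rewrite !E E1 E2 E3 -e; field; rewrite !gt_eqF.
Qed.

(** Only one term survives: its argument [c / (2 sqrt t) - z sqrt t] tends to [-oo], where [erfc]
    tends to 2. *)
Lemma cvg_primitive_pinfty c z : 0 < c -> 0 < z ->
  primitive c z t @[t --> +oo] --> expR (- (c * z)) / z ^+ 2.
Proof.
move=> c0 z0; have z20 : 0 < z ^+ 2 by rewrite exprn_gt0.
have cu : \forall t \near +oo, c / (2 * Num.sqrt t) <= c.
  have := cvg_sqrt_pinfty => /cvgryPge/(_ 1); apply: filterS => t t1.
  by rewrite ler_pdivrMr ?ler_peMr; lra.
have cw : c / (2 * Num.sqrt t) + z * Num.sqrt t @[t --> +oo] --> (+oo : set_system R).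
  apply/cvgryPge => A.
  have := cvg_sqrt_pinfty => /cvgryPge/(_ (A / z)); apply: filterS => t.
  rewrite ler_pdivrMr// => At; rewrite [z * _]mulrC.
  have : 0 <= c / (2 * Num.sqrt t) by rewrite divr_ge0 ?mulr_ge0 ?sqrtr_ge0 ?ltW.
  lra.
have cv : c / (2 * Num.sqrt t) + (- z) * Num.sqrt t @[t --> +oo] --> (-oo : set_system R).
  apply/cvgrNyPle => A.
  have := cvg_sqrt_pinfty => /cvgryPge/(_ ((c - A) / z)) h.
  near=> t.
  have : c / (2 * Num.sqrt t) <= c by near: t.
  have : (c - A) / z <= Num.sqrt t by near: t.
  rewrite ler_pdivrMr// mulNr [Num.sqrt t * z]mulrC; lra.
have ce : expR (- (z ^+ 2 * t)) * erfc (c / (2 * Num.sqrt t)) @[t --> +oo] --> (0 : R).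
  have h : expR (- (z ^+ 2 * t)) * 2 @[t --> +oo] --> (0 * 2 : R).
    by apply: cvgM; [exact: cvg_expRN_pinfty|exact: cvg_cst].
  rewrite mul0r in h; apply: squeeze_cvgr (cvg_cst 0) h.
  apply: nearW => t; rewrite mulr_ge0 ?expR_ge0 ?erfc_ge0//=.
  by rewrite ler_wpM2l ?expR_ge0// erfc_le2.
rewrite (_ : expR (- (c * z)) / z ^+ 2 = (2 * z ^+ 2)^-1 *
  (expR (- (c * z)) * 2 + expR (c * z) * 0) - (z ^+ 2)^-1 * 0); last first.
  by field; rewrite gt_eqF.
apply: cvgB; last by apply: cvgM => //; exact: cvg_cst.
apply: cvgM; first exact: cvg_cst.
apply: cvgD; (apply: cvgM; first exact: cvg_cst).
  exact: (cvg_comp _ _ cv (@cvg_erfc_ninfty R)).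
exact: (cvg_comp _ _ cw (@cvg_erfc_pinfty R)).
Unshelve. all: by end_near. Qed.

Lemma cvg_primitive_right0 c z : 0 < c -> 0 < z ->
  primitive c z t @[t --> (0 : R)^'+] --> (0 : R).
Proof.
move=> c0 z0.
have e y : erfc (c / (2 * Num.sqrt t) + y * Num.sqrt t) @[t --> (0 : R)^'+] --> (0 : R).
  exact: (cvg_comp _ _ (cvg_shift_sqrt_right0 y c0) (@cvg_erfc_pinfty R)).
have e0 : expR (- (z ^+ 2 * t)) * erfc (c / (2 * Num.sqrt t)) @[t --> (0 : R)^'+] --> (0 : R).
  have h := cvg_comp _ _ (cvg_div_sqrt_right0 c0) (@cvg_erfc_pinfty R).
  apply: squeeze_cvgr (cvg_cst 0) h.
  near=> t; have t0 : 0 < t by near: t; exact: nbhs_right_gt.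
  rewrite mulr_ge0 ?expR_ge0 ?erfc_ge0//= ler_piMl ?erfc_ge0//.
  by rewrite expR_le1 oppr_le0 mulr_ge0 ?sqr_ge0// ltW.
suff : primitive c z t @[t --> (0 : R)^'+] --> (2 * z ^+ 2)^-1 *
    (expR (- (c * z)) * 0 + expR (c * z) * 0) - (z ^+ 2)^-1 * 0.
  by rewrite !mulr0 addr0 mulr0 subr0.
apply: cvgB; last by apply: cvgM => //; exact: cvg_cst.
apply: cvgM; first exact: cvg_cst.
by apply: cvgD; (apply: cvgM; first exact: cvg_cst).
Unshelve. all: by end_near. Qed.

Lemma continuous_erfc_div_sqrt c t : 0 < t ->
  {for t, continuous (fun t => erfc (c / (2 * Num.sqrt t)))}.
Proof.
move=> t0; have r0 : 0 < 2 * Num.sqrt t by rewrite mulr_gt0// sqrtr_gt0.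
apply: continuous_comp; last exact: continuous_erfc.
apply: cvgM; first exact: cvg_cst.
apply: cvgV; first by rewrite gt_eqF.
by apply: cvgM; [exact: cvg_cst|exact: sqrt_continuous].
Qed.

Lemma measurable_erfc_div_sqrt c :
  measurable_fun Rp (fun t => erfc (c / (2 * Num.sqrt t))).
Proof.
apply: open_continuous_measurable_fun; first exact: interval_open.
by move=> t; rewrite inE/= in_itv/= andbT; exact: continuous_erfc_div_sqrt.
Qed.

Lemma has_laplace_erfc c : has_laplace (fun t => erfc (c / (2 * Num.sqrt t))).
Proof.
have -> : (fun t => erfc (c / (2 * Num.sqrt t))) =
    (fun t => erfc (c / (2 * Num.sqrt t)) * 1) :> (R -> R).
  by apply/funext => t; rewrite mulr1.
apply: (has_laplaceM (M := 2) (has_laplace_cst 1) (measurable_erfc_div_sqrt c)).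
by move=> t _; rewrite ger0_norm ?erfc_ge0// erfc_le2.
Qed.

Lemma rlaplace_erfc c s : 0 < c -> 0 < s ->
  rlaplace (fun t => erfc (c / (2 * Num.sqrt t))) s = expR (- (c * Num.sqrt s)) / s.
Proof.
move=> c0 s0; set z := Num.sqrt s; have z0 : 0 < z by rewrite sqrtr_gt0.
have zs : z ^+ 2 = s by rewrite sqr_sqrtr// ltW.
have [_ /(_ s s0)/measurable_int mf] := has_laplace_erfc c.
pose f t := expR (- (s * t)) * erfc (c / (2 * Num.sqrt t)).
(* At [t = 0] the conventions give [c / 0 = 0] and [erfc 0 = 1], whereas the right limit is 0; [g]
   and [G] restore continuity at the left end. *)
pose g t := if 0 < t then f t else 0.
pose G t := if 0 < t then primitive c z t else 0.
have dG t : 0 < t -> is_derive t 1 G (g t).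
  move=> t0; have := is_derive_primitive c z0 t0.
  have -> : g t = f t by rewrite /g t0.
  rewrite zs; apply: near_eq_is_derive; near=> x.
  by rewrite /G ifT//; near: x; exact: lt_nbhsr.
have gf : {in Rp, f =1 g} by move=> t; rewrite inE/= in_itv/= andbT /g => ->.
have -> : rlaplace (fun t => erfc (c / (2 * Num.sqrt t))) s = \int[mu]_(t in Rp) g t.
  by apply: eq_Rintegral => t tR; exact: gf.
rewrite /Rintegral integral_itv_obnd_cbnd; last first.
  by apply: eq_measurable_fun mf => t /gf /= <-.
rewrite (@ge0_continuous_FTC2y R g G 0 (expR (- (c * z)) / s)).
- by rewrite -EFinB /= /G ltxx subr0.
- by move=> t _; rewrite /g /f; case: ifP => // _; rewrite mulr_ge0 ?expR_ge0 ?erfc_ge0.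
- apply/continuous_within_itvcyP; split.
    move=> t; rewrite in_itv/= andbT => t0.
    have ce : {for t, continuous (fun x : R => expR (- (s * x)))}.
      apply/differentiable_continuous/derivable1_diffP.
      by have [] := is_derive_expRN s t.
    have cf : f x @[x --> t] --> f t.
      by apply: cvgM; [exact: ce|exact: continuous_erfc_div_sqrt].
    have gt : g t = f t by rewrite /g t0.
    rewrite /continuous_at gt; apply: cvg_trans cf; apply: near_eq_cvg; near=> x.
    by rewrite /g ifT//; near: x; exact: lt_nbhsr.
  have -> : g 0 = 0 by rewrite /g ltxx.
  have h := cvg_comp _ _ (cvg_div_sqrt_right0 c0) (@cvg_erfc_pinfty R).
  apply: squeeze_cvgr (cvg_cst 0) h; near=> t.
  have t0 : 0 < t by near: t; exact: nbhs_right_gt.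
  rewrite /g t0 /f mulr_ge0 ?expR_ge0 ?erfc_ge0//= ler_piMl ?erfc_ge0//.
  by rewrite expR_le1 oppr_le0 mulr_ge0// ltW.
- have h := cvg_primitive_pinfty c0 z0; rewrite zs in h; apply: cvg_trans h.
  apply: near_eq_cvg; near=> t.
  have t0 : 0 < t by near: t; apply: nbhs_pinfty_gt; exact: num_real.
  by rewrite /G t0.
- by move=> t t0; have [] := dG t t0.
- have -> : G 0 = 0 by rewrite /G ltxx.
  apply: cvg_trans (cvg_primitive_right0 c0 z0).
  apply: near_eq_cvg; near=> t.
  have t0 : 0 < t by near: t; exact: nbhs_right_gt.
  by rewrite /G t0.
- by move=> t; rewrite in_itv/= andbT => t0; rewrite derive1E; have [_ ->] := dG t t0.
Unshelve. all: by end_near. Qed.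

End laplace_erfc.

(** * The interface symbol *)

Section second_order_ode.
Variable R : realType.
Implicit Types (a b x y z : R) (f U : R -> R).

Lemma is_derive0_within_cst f a b :
  {within `[a, b], continuous f} -> (forall x, a < x < b -> is_derive x 1 f 0) ->
  forall x y, a <= x <= b -> a <= y <= b -> f x = f y.
Proof.
move=> cf df; suff h x y : a <= x -> x < y -> y <= b -> f x = f y.
  move=> x y /andP[ax xb] /andP[ay yb].
  by have [xy|yx|->//] := ltgtP x y; [exact: h|apply/esym; exact: h].
move=> ax xy yb.
have [||c _] := @MVT R f (cst 0) x y xy.
- move=> c; rewrite in_itv/= => /andP[xc cy]; apply: df.
  by rewrite (le_lt_trans ax xc) (lt_le_trans cy yb).
- by apply: continuous_subspaceW cf; apply: subset_itv; rewrite bnd_simp.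
by rewrite /= mul0r => /eqP; rewrite subr_eq0 => /eqP.
Qed.

Lemma is_derive_expRM z x : is_derive x 1 (fun x => expR (z * x)) (z * expR (z * x)).
Proof.
have d : is_derive x 1 (fun x => z * x) z.
  rewrite (_ : (fun x => z * x) = z \*: id)//.
  by apply: is_derive_eq; rewrite /GRing.scale /= mulr1.
have := @is_derive1_comp R expR (fun x => z * x) x _ _ (is_derive_expR _) d.
by rewrite mulrC.
Qed.

(** Factors the operator as [(D - z) (D + z)] and integrates the two first-order equations in turn,
    by [g] and [k]. *)
Lemma ode2_sol z a b U : 0 < z -> a < b -> {within `[a, b], continuous U} ->
  (forall x, a < x < b ->
    [/\ derivable U x 1, derivable (derive1 U) x 1 & derive1 (derive1 U) x = z ^+ 2 * U x]) ->
  exists A B, forall x, a <= x <= b -> U x = A * expR (z * x) + B * expR (- z * x).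
Proof.
move=> z0 ab cU dU.
have dU1 x : a < x < b -> is_derive x 1 U (derive1 U x).
  by move=> /dU[d _ _]; rewrite derive1E; exact: derivableP.
have dU2 x : a < x < b -> is_derive x 1 (derive1 U) (z ^+ 2 * U x).
  by move=> /dU[_ d <-]; rewrite [in X in is_derive _ _ _ X]derive1E; exact: derivableP.
pose g := (fun x => expR (- z * x)) * ((derive1 U) + z \*: U).
have dg x : a < x < b -> is_derive x 1 g 0.
  move=> xab; have d1 := dU1 x xab; have d2 := dU2 x xab.
  have d3 := is_derive_expRM (- z) x.
  apply: (is_derive_eq (is_deriveM d3 (is_deriveD d2 (is_deriveZ z d1)))).
  change (expR (- z * x) * (z ^+ 2 * U x + z * derive1 U x) +
    (derive1 U x + z * U x) * (- z * expR (- z * x)) = 0); ring.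
(* An interior reference point, as [g] contains [derive1 U], about which nothing is known at the end
   points. *)
pose m := (a + b) / 2.
have gm x : a < x < b -> g x = g m.
  move=> /andP[ax xb]; have ? : a < m < b by rewrite /m; apply/andP; split; lra.
  have sub y : Num.min x m <= y <= Num.max x m -> a < y < b.
    move=> /andP[h1 h2]; apply/andP; split.
      by apply: lt_le_trans h1; rewrite lt_min ax; lra.
    by apply: le_lt_trans h2 _; rewrite gt_max xb; lra.
  apply: (@is_derive0_within_cst g (Num.min x m) (Num.max x m)).
  - by apply: derivable_within_continuous => y; rewrite in_itv/= => /sub/dg[].
  - by move=> y /andP[y1 y2]; apply/dg/sub; rewrite !ltW.
  - by rewrite ge_min lexx le_max lexx.
  - by rewrite ge_min lexx le_max lexx !orbT.
(* The derivative of [expR (z x) * U x] is [g m * expR (2 z x)]. Since [k] contains no derivative of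
   [U], its constancy extends to the closed interval. *)
pose k := (fun x => expR (z * x)) * U - (g m / (2 * z)) \*: (fun x => expR (2 * z * x)).
have dk x : a < x < b -> is_derive x 1 k 0.
  move=> xab; have d1 := dU1 x xab.
  have d3 := is_derive_expRM z x; have d4 := is_derive_expRM (2 * z) x.
  apply: (is_derive_eq (is_deriveB (is_deriveM d3 d1) (is_deriveZ (g m / (2 * z)) d4))).
  change (expR (z * x) * derive1 U x + U x * (z * expR (z * x)) -
    (g m / (2 * z)) * (2 * z * expR (2 * z * x)) = 0).
  have e : expR (2 * z * x) = expR (z * x) * expR (z * x) by rewrite -expRD; congr expR; ring.
  have e1 : expR (- z * x) * expR (z * x) = 1.
    by rewrite -expRD (_ : - z * x + z * x = 0) ?expR0//; ring.
  rewrite -(gm x xab) e.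
  change (expR (z * x) * derive1 U x + U x * (z * expR (z * x)) -
    ((expR (- z * x) * (derive1 U x + z * U x)) / (2 * z)) * (2 * z * (expR (z * x) * expR (z * x))) = 0).
  rewrite [X in _ - X](_ : _ = (expR (- z * x) * expR (z * x)) * (derive1 U x + z * U x) * expR (z * x)).
    by rewrite e1; ring.
  by field; rewrite gt_eqF.
have ck : {within `[a, b], continuous k}.
  have cE c : {within `[a, b], continuous (fun x : R => expR (c * x))}.
    apply: continuous_subspaceT => x; apply/differentiable_continuous/derivable1_diffP.
    by have [] := is_derive_expRM c x.
  move=> x; apply: cvgB; first by apply: cvgM; [exact: cE|exact: cU].
  by apply: cvgZr; exact: cE.
exists (g m / (2 * z)), (k a) => x xab.
have e1 : expR (- z * x) * expR (z * x) = 1.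
  by rewrite -expRD (_ : - z * x + z * x = 0) ?expR0//; ring.
have <- : k x = k a.
  by apply: (is_derive0_within_cst ck dk) => //; rewrite lexx ltW.
change (U x = g m / (2 * z) * expR (z * x) +
  (expR (z * x) * U x - g m / (2 * z) * expR (2 * z * x)) * expR (- z * x)).
have -> : expR (2 * z * x) = expR (z * x) * expR (z * x) by rewrite -expRD; congr expR; ring.
set w := g m / _; set P := expR (z * x) in e1 *; set Q := expR (- z * x) in e1 *.
transitivity (w * P + U x * (Q * P) - w * P * (Q * P)); first by rewrite e1; ring.
by ring.
Qed.

Lemma is_derive_expR_comb A B z x :
  is_derive x 1 (fun x => A * expR (z * x) + B * expR (- z * x))
    (z * (A * expR (z * x) - B * expR (- z * x))).
Proof.
have d1 := is_derive_expRM z x; have d2 := is_derive_expRM (- z) x.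
rewrite (_ : (fun x => _) = A \*: (fun x => expR (z * x)) + B \*: (fun x => expR (- z * x)))//.
apply: (is_derive_eq (is_deriveD (is_deriveZ A d1) (is_deriveZ B d2))).
change (A * (z * expR (z * x)) + B * (- z * expR (- z * x)) =
  z * (A * expR (z * x) - B * expR (- z * x))); ring.
Qed.

(** The abstract filter serves both one-sided fluxes at the interface. *)
Lemma difference_quotient_expR_comb A B z U p (F : set_system R) :
  ProperFilter F -> F `=>` (0 : R)^' ->
  (\forall x \near F, U x = A * expR (z * x) + B * expR (- z * x)) ->
  U 0 = A + B ->
  (U e - U 0) / e @[e --> F] --> p -> p = z * (A - B).
Proof.
move=> PF F0 UF U0 Up.
have [d dE] := is_derive_expR_comb A B z 0.
rewrite !mulr0 expR0 !mulr1 in dE.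
apply: (cvg_unique _ Up); first exact: Rhausdorff.
rewrite /= -dE.
have h := cvg_trans (cvg_app _ F0) d.
apply: cvg_trans h; apply: near_eq_cvg; near=> e.
have Ue : U e = A * expR (z * e) + B * expR (- z * e) by near: e.
rewrite Ue U0 /= addr0 !mulr0 expR0 !mulr1 [RHS]mulrC.
by rewrite /GRing.scale /= !mulr1.
Unshelve. all: by end_near. Qed.

Lemma at_left0_dnbhs : (0 : R)^'- `=>` (0 : R)^'.
Proof. by move=> P; rewrite /dnbhs /at_left /within/=; apply: filterS => y h y0; apply: h; rewrite lt_eqF. Qed.

Lemma at_right0_dnbhs : (0 : R)^'+ `=>` (0 : R)^'.
Proof. by move=> P; rewrite /dnbhs /at_right /within/=; apply: filterS => y h y0; apply: h; rewrite gt_eqF. Qed.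

End second_order_ode.

(** * The symbol of one iteration step *)

Section interface_symbol.
Variable R : realType.
Implicit Types (a b z : R) (U : R -> R).

(** A Dirichlet-to-Neumann relation: the outer boundary condition ties the interface flux
    [z (A - B)] to the interface value [A + B]. With the coefficients exchanged it serves the
    Neumann side. *)
Lemma expR_comb_zero A B z a : A * expR (- (z * a)) + B * expR (z * a) = 0 ->
  (A - B) * sinh (a * z) = (A + B) * cosh (a * z).
Proof.
by rewrite /sinh /cosh [a * z]mulrC => h; lra.
Qed.

Lemma Re_real_mul (x : R) (w : R[i]) :
  complex.Re (x%:C * w) = x * complex.Re w.
Proof. by case: w => c d /=; ring. Qed.

Lemma heat_laplace_sol_expR (s x1 x2 : R) (u : R -> R[i]) : 0 < s -> x1 < x2 ->
  heat_laplace_sol x1 x2 s%:C u ->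
  exists A B, forall x, x1 <= x <= x2 ->
    complex.Re (u x) = A * expR (Num.sqrt s * x) + B * expR (- Num.sqrt s * x).
Proof.
move=> s0 x12 [cu _ du]; apply: ode2_sol => //; first by rewrite sqrtr_gt0.
move=> x /du[[d _] [d1 _]] /(congr1 (@complex.Re R)) /= h; split => //.
rewrite sqr_sqrtr ?ltW//; apply/eqP; rewrite eq_sym -subr_eq0; apply/eqP; rewrite -[RHS]h.
by rewrite raddfB /= Re_real_mul.
Qed.

(* With [z = sqrt s],
   [(1 - tanh (b z) / tanh (a z)) / 2 = sinh ((a - b) z) / sinh (a z) * sinh (b z) / sinh (2 b z)]. *)
Lemma dnwr_step_symbol (a b s : R) (p g : R[i]) (u1 u2 : R -> R[i]) :
  0 < b -> b < a -> 0 < s ->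
  dirichlet_problem a s%:C g u1 -> is_left_cderive u1 0 p ->
  neumann_problem b s%:C p u2 ->
  (complex.Re (u2 0) + complex.Re g) / 2 =
    sinh_ratio (a - b) a s * sinh_ratio b (2 * b) s * complex.Re g.
Proof.
move=> b0 ba s0 [sol1 u1a u10] [dp _] [sol2 [dq _] u2b].
have a0 : 0 < a by exact: lt_trans ba.
have ma : - a < 0 by lra.
have [A [B E1]] := heat_laplace_sol_expR s0 ma sol1.
have [C [D E2]] := heat_laplace_sol_expR s0 b0 sol2.
set z := Num.sqrt s in E1 E2 *; have z0 : 0 < z by rewrite sqrtr_gt0.
have e10 : complex.Re g = A + B by rewrite -u10 E1 ?mulr0 ?expR0 ?mulr1//; lra.
have e20 : complex.Re (u2 0) = C + D by rewrite E2 ?mulr0 ?expR0 ?mulr1//; lra.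
have e1a : A * expR (- (z * a)) + B * expR (z * a) = 0.
  have := E1 (- a); rewrite u1a /= mulrN mulNr mulrN opprK => <- //; lra.
have e2b : D * expR (- (z * b)) + C * expR (z * b) = 0.
  have := E2 b; rewrite u2b /= mulNr addrC => <- //; lra.
have pAB : complex.Re p = z * (A - B).
  have h1 : \forall x \near (0 : R)^'-, complex.Re (u1 x) = A * expR (z * x) + B * expR (- z * x).
    near=> x; apply: E1; apply/andP; split; last by apply: ltW; near: x; exact: nbhs_left_lt.
    by near: x; exact: nbhs_left_ge.
  have h2 : complex.Re (u1 0) = A + B by rewrite u10.
  move: dp; under eq_cvg do rewrite add0r.
  exact: (@difference_quotient_expR_comb _ _ _ _ (fun x => complex.Re (u1 x)) _ _ _ (@at_left0_dnbhs R) h1 h2).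
have pCD : complex.Re p = z * (C - D).
  have h1 : \forall x \near (0 : R)^'+, complex.Re (u2 x) = C * expR (z * x) + D * expR (- z * x).
    near=> x; apply: E2; apply/andP; split; first by apply: ltW; near: x; exact: nbhs_right_gt.
    by near: x; exact: nbhs_right_le.
  move: dq; under eq_cvg do rewrite add0r.
  exact: (@difference_quotient_expR_comb _ _ _ _ (fun x => complex.Re (u2 x)) _ _ _ (@at_right0_dnbhs R) h1 e20).
have CD : C - D = A - B.
  by apply: (mulfI (lt0r_neq0 z0)); rewrite -pCD.
have hA := expR_comb_zero e1a; have hD := expR_comb_zero e2b.
rewrite e10 e20 /sinh_ratio -/z.
have sa : 0 < sinh (a * z) by rewrite sinh_gt0// mulr_gt0.
have sb : 0 < sinh (b * z) by rewrite sinh_gt0// mulr_gt0.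
have cb := cosh_gt0 (b * z).
have -> : (a - b) * z = a * z - b * z by ring.
have -> : 2 * b * z = b * z + b * z by ring.
rewrite sinhB sinhD.
move: hA hD; set Sa := sinh (a * z) in sa *; set Sb := sinh (b * z) in sb *.
set Ca := cosh (a * z); set Cb := cosh (b * z) in cb *.
move=> hA hD.
(* The Neumann trace is [- tanh (b z) / tanh (a z)] times the Dirichlet trace. *)
have CDE : C + D = - ((A + B) * Ca / Sa) * Sb / Cb.
  rewrite -hA mulfK ?gt_eqF//; apply: (mulIf (lt0r_neq0 cb)).
  by rewrite divfK ?gt_eqF// addrC -hD mulNr -CD; ring.
by rewrite CDE; field; rewrite !gt_eqF//; nra.
Unshelve. all: by end_near. Qed.
End interface_symbol.

(** * Domination and the error estimates *)

#[local] Instance ae_lebesgue_filter (R : realType) :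
  Filter (almost_everywhere (@lebesgue_measure R)) :=
  ae_filter_ringOfSetsType (@lebesgue_measure R).

Section domination.
Variable R : realType.
Notation mu := (@lebesgue_measure R).
Notation Rp := (`]0%R, +oo[%classic : set R).
Implicit Types (f g : R -> R) (s : R).

Lemma rlaplace_ge0 f s : has_laplace f -> {ae mu, forall t, Rp t -> 0 <= f t} ->
  0 < s -> 0 <= rlaplace f s.
Proof.
move=> [_ If] f0 s0; have mf := measurable_int _ (If s s0).
rewrite /rlaplace /Rintegral.
rewrite (@ae_eq_integral _ _ _ mu Rp (fun t => `|(expR (- (s * t)) * f t)%:E|%E)) //.
- by apply: fine_ge0; apply: integral_ge0.
- exact: measurableT_comp mf.
apply: filterS f0 => t ft Rt; rewrite gee0_abs// lee_fin.
by rewrite mulr_ge0 ?expR_ge0// ft.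
Qed.

Lemma cm_rlaplace f : has_laplace f -> {ae mu, forall t, Rp t -> 0 <= f t} ->
  cm (rlaplace f).
Proof.
move=> + + n; elim: n f => [|n IH] f hf f0.
  by split => // s; exact: rlaplace_ge0.
split; first by move=> s; exact: rlaplace_ge0.
have [hg g0] : has_laplace (fun t => (1 - expR (- t)) * f t) /\
    {ae mu, forall t, Rp t -> 0 <= (1 - expR (- t)) * f t}.
  split; first exact: has_laplace_1BexpRN.
  apply: filterS f0 => t f0 Rt; rewrite mulr_ge0 ?f0//.
  by move: Rt; rewrite /= in_itv/= andbT => t0; rewrite subr_ge0 expR_le1 oppr_le0 ltW.
by apply: eq_cmn (IH _ hg g0) => s s0; rewrite rlaplace_fdiff.
Qed.

(** A comparison principle: for either sign [e], the transform of [g + e h] is that of [g] minus [Q]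
    times that of [g0], plus [Q] times that of [g0 + e h0]. A nonconstant majorant [g0] is what the
    estimate on [(0, T)] requires. *)
Lemma ae_le_of_cm_laplace (Q h0 h g0 g : R -> R) :
  has_laplace h0 -> has_laplace h -> has_laplace g0 -> has_laplace g -> cm Q ->
  {ae mu, forall t, Rp t -> `|h0 t| <= g0 t} ->
  (forall s, 0 < s -> rlaplace h s = Q s * rlaplace h0 s) ->
  cm (fun s => rlaplace g s - Q s * rlaplace g0 s) ->
  {ae mu, forall t, Rp t -> `|h t| <= g t}.
Proof.
move=> hh0 hh hg0 hg cQ h0g0 hQ cg.
have key e : `|e| = 1 -> {ae mu, forall t, Rp t -> 0 <= g t + e * h t}.
  move=> e1; apply: cm_laplace_ge0; split.
    by apply: has_laplaceD => //; exact: has_laplaceZ.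
  have c0 : cm (rlaplace (fun t => g0 t + e * h0 t)).
    apply: cm_rlaplace; first by apply: has_laplaceD => //; exact: has_laplaceZ.
    apply: filterS h0g0 => t h0g0 Rt.
    have := h0g0 Rt; rewrite -[`|h0 t|]mul1r -e1 -normrM ler_norml; lra.
  apply: eq_cm (cmD cg (cmM cQ c0)) => s s0.
  by rewrite !rlaplaceD ?rlaplaceZ ?hQ//; [ring|exact: has_laplaceZ|exact: has_laplaceZ].
have e1 : `|1| = 1 :> R by rewrite normr1.
have e2 : `|-1| = 1 :> R by rewrite normrN1.
apply: filterS2 (key 1 e1) (key (-1) e2) => t k1 k2 Rt.
by rewrite ler_norml; have := k1 Rt; have := k2 Rt; lra.
Qed.

Lemma Linfty_normE (D : set R) f :
  Linfty_norm D f = ess_sup mu (abse \o (EFin \o (f \_ D))).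
Proof.
have muT : (0 < mu [set: R])%E by rewrite -set_itvNyy lebesgue_measure_itv/= ltry.
by rewrite /Linfty_norm unlock /Lnorm ifT.
Qed.

Lemma Linfty_norm_ge (D : set R) f :
  {ae mu, forall t, D t -> (`|f t|%:E <= Linfty_norm D f)%E}.
Proof.
rewrite Linfty_normE; have := ess_sup_ge mu (abse \o (EFin \o (f \_ D))).
by apply: filterS => t + Dt; rewrite /= patchE mem_set.
Qed.

Lemma Linfty_norm_le (D : set R) f (y : R) : 0 <= y ->
  {ae mu, forall t, D t -> `|f t| <= y} -> (Linfty_norm D f <= y%:E)%E.
Proof.
move=> y0 fy; rewrite Linfty_normE; apply/ess_supP.
apply: filterS fy => t fy; rewrite /= patchE lee_fin.
by case: ifPn => [|_]; [rewrite inE => /fy|rewrite normr0].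
Qed.

Lemma Linfty_norm_ge0 (D : set R) f : (0 <= Linfty_norm D f)%E.
Proof. exact: Lnorm_ge0. Qed.

Lemma Linfty_norm_subset (D E : set R) f : D `<=` E ->
  (Linfty_norm D f <= Linfty_norm E f)%E.
Proof.
move=> DE; rewrite !Linfty_normE; apply: le_ess_sup; apply: aeW => t.
rewrite /= !patchE; case: ifPn => [|_]; last by rewrite normr0 lee_fin.
by rewrite inE => /DE Et; rewrite mem_set.
Qed.

End domination.

(** * The linear and superlinear estimates *)

Section dnwr.
Variable R : realType.
Notation mu := (@lebesgue_measure R).
Notation Rp := (`]0%R, +oo[%classic : set R).

Lemma has_laplace_inverse (F : R[i] -> R[i]) (f : R -> R) :
  is_inverse_laplace F f -> has_laplace f.
Proof.
move=> [mf If _]; split => // s s0.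
have := If s s0; congr (_.-integrable _ _).
by apply/funext => t /=; rewrite mulNr.
Qed.

Lemma Re_inverse_laplace (F : R[i] -> R[i]) (f : R -> R) s : 0 < s ->
  is_inverse_laplace F f -> complex.Re (F s%:C) = rlaplace f s.
Proof.
move=> s0 [_ _ /(_ s%:C s0) <-]; rewrite /laplace /=.
apply: eq_Rintegral => t _.
by rewrite !(mulr0, mul0r, oppr0, addr0, subr0) cos0 mulr1 mulNr.
Qed.

Definition dnwr_symbol (a b s : R) : R := sinh_ratio (a - b) a s * sinh_ratio b (2 * b) s.

Lemma dnwr_rlaplace (a b : R) (h : nat -> R -> R) : 0 < b -> b < a ->
  dnwr_iteration a b (1 / 2) h ->
  (forall k, has_laplace (h k)) /\
  forall k s, 0 < s -> rlaplace (h k) s = dnwr_symbol a b s ^+ k * rlaplace (h 0%N) s.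
Proof.
move=> b0 ba [_ [H [u1 [u2 [invH step]]]]]; split.
  by move=> k; exact: has_laplace_inverse (invH k).
move=> k s s0; elim: k => [|k IH]; first by rewrite mul1r.
rewrite exprS -mulrA -IH -!(Re_inverse_laplace s0 (invH _)).
have [D [p lp N] ->] := step k s%:C s0.
rewrite -(dnwr_step_symbol b0 ba s0 D lp N) raddfD /= !Re_real_mul; lra.
Qed.

(** With [E = expR (- x)] the ratio is [S = (2 cosh x)^-1 = E / (1 + E^2)], hence
    [E - S = E^2 S]. *)
Lemma sinh_ratio_double (b s : R) : 0 < b -> 0 < s ->
  expR (- (b * Num.sqrt s)) - sinh_ratio b (2 * b) s =
  expR (- (b * Num.sqrt s)) * expR (- (b * Num.sqrt s)) * sinh_ratio b (2 * b) s.
Proof.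
move=> b0 s0; have x0 : 0 < b * Num.sqrt s by rewrite mulr_gt0// sqrtr_gt0.
rewrite /sinh_ratio -mulrA; set x := b * _ in x0 *.
have sx := sinh_gt0 x0; have cx := cosh_gt0 x.
have -> : 2 * x = x + x by ring.
have -> : sinh x / sinh (x + x) = (2 * cosh x)^-1.
  by rewrite sinhD; field; rewrite !gt_eqF//; nra.
rewrite /cosh; have := expR_gt0 x; rewrite expRN => e0.
by field; rewrite !gt_eqF//; nra.
Qed.

(** By induction on [E^(k+1) - S^(k+1) = E^k (E - S) + S (E^k - S^k)]. *)
Lemma cm_expR_sqrt_sub (b : R) k : 0 < b ->
  cm (fun s => expR (- (b * Num.sqrt s)) ^+ k - sinh_ratio b (2 * b) s ^+ k).
Proof.
move=> b0; have [cE _] := cm_mass_expR_sqrt b0.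
have [cS _] : cm_mass (sinh_ratio b (2 * b)) (b / (2 * b)) by apply: cm_mass_sinh_ratio; lra.
elim: k => [|k IH].
  by apply: eq_cm (cm_cst (lexx 0)) => s _; rewrite subrr.
apply: eq_cm (cmD (cmM (cmX k cE) (cmM (cmM cE cE) cS)) (cmM cS IH)) => s s0.
by rewrite -sinh_ratio_double// !exprS; ring.
Qed.

Lemma cm_mass_dnwr_symbol (a b : R) : 0 < b -> b < a ->
  cm_mass (dnwr_symbol a b) ((a - b) / (2 * a)).
Proof.
move=> b0 ba.
have -> : (a - b) / (2 * a) = (a - b) / a * (b / (2 * b)).
  by field; rewrite !gt_eqF//; lra.
by apply: cm_massM; apply: cm_mass_sinh_ratio; lra.
Qed.

Lemma dnwr_linear (a b M : R) (h : nat -> R -> R) k : 0 < b -> b < a ->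
  dnwr_iteration a b (1 / 2) h -> 0 <= M ->
  {ae mu, forall t, Rp t -> `|h 0%N t| <= M} ->
  {ae mu, forall t, Rp t -> `|h k t| <= ((a - b) / (2 * a)) ^+ k * M}.
Proof.
move=> b0 ba it M0 h0M; have [hh hE] := dnwr_rlaplace b0 ba it.
have [cQ crQ] := cm_massX k (cm_mass_dnwr_symbol b0 ba).
apply: (ae_le_of_cm_laplace (hh 0%N) (hh k) (has_laplace_cst M)
  (has_laplace_cst _) cQ h0M (hE k)).
by apply: eq_cm (cmZ M0 crQ) => s s0; rewrite !rlaplace_cst//; ring.
Qed.

(** The initial guess is at most [m] before [T] but possibly as large as [M] afterwards, so it is
    majorized by [m + (M - m) * I t]. The part carried by [I] stays in [[T, +oo[] and disappears on
    []0, T[], so [M] leaves no trace. *)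
Lemma dnwr_superlinear (a b T m M : R) (h : nat -> R -> R) k : 0 < b -> b < a ->
  dnwr_iteration a b (1 / 2) h -> 0 < T -> (0 < k)%N -> 0 <= m -> m <= M ->
  {ae mu, forall t, Rp t -> `|h 0%N t| <= M} ->
  {ae mu, forall t, (`]0, T[%classic : set R) t -> `|h 0%N t| <= m} ->
  {ae mu, forall t, (`]0, T[%classic : set R) t ->
    `|h k t| <= ((a - b) / a) ^+ k * erfc (k%:R * b / (2 * Num.sqrt T)) * m}.
Proof.
move=> b0 ba it T0 k0 m0 mM h0M h0m; have [hh hE] := dnwr_rlaplace b0 ba it.
have kb : 0 < k%:R * b by rewrite mulr_gt0// ltr0n.
pose I : R -> R := \1_(`[T, +oo[%classic : set R).
pose c := ((a - b) / a) ^+ k.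
pose E (t : R) : R := erfc (k%:R * b / (2 * Num.sqrt t)).
have [hI hC hE'] := And3 (has_laplace_indic T) (has_laplace_cst m) (has_laplace_erfc (k%:R * b)).
have hMI := has_laplaceZ (M - m) hI.
have hmE := has_laplaceZ m hE'.
have Mm : 0 <= M - m by rewrite subr_ge0.
have [cS crS] : cm_mass (fun s => sinh_ratio (a - b) a s ^+ k) c.
  by apply: cm_massX; apply: cm_mass_sinh_ratio; lra.
have mQ := cm_massX k (cm_mass_dnwr_symbol b0 ba).
have [cQ _] := mQ.
have c0 : 0 <= c by rewrite exprn_ge0// divr_ge0; lra.
have crQ : cm (fun s => (c - dnwr_symbol a b s ^+ k) / s).
  (* The mass of the symbol's power is [c / 2 ^+ k]; the surplus adds a nonnegative multiple of
     [1 / s]. *)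
  have cc : 0 <= c - ((a - b) / (2 * a)) ^+ k.
    rewrite subr_ge0 ler_pXn2r ?nnegrE ?divr_ge0 ?mulr_ge0//; try lra.
    by rewrite ler_pM2l ?subr_gt0// lef_pV2 ?posrE; lra.
  by apply: eq_cm (cmD (cmZ cc (@cm_invs R)) mQ.2) => s _; ring.
have [cX _] := cm_mass_expR_sqrt kb.
have cdiff : cm (fun s => (c * expR (- (k%:R * b * Num.sqrt s)) - dnwr_symbol a b s ^+ k) / s).
  (* With [r] the first factor of the symbol: [c E^k - (r S)^k = E^k (c - r^k) + r^k (E^k -
     S^k)]. *)
  apply: eq_cm (cmD (cmM cX crS) (cmM (cmM cS (cm_expR_sqrt_sub k b0)) (@cm_invs R))) => s s0.
  have -> : expR (- (b * Num.sqrt s)) ^+ k = expR (- (k%:R * b * Num.sqrt s)).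
    by rewrite -expRM_natl; congr expR; ring.
  by rewrite /dnwr_symbol [in RHS]exprMn; ring.
have key : {ae mu, forall t, Rp t -> `|h k t| <= c * (m * E t + (M - m) * I t)}.
  apply: (@ae_le_of_cm_laplace _ _ (h 0%N) _ (fun t => m + (M - m) * I t) _
    (hh 0%N) (hh k) _ _ cQ _ (hE k)).
  - exact: has_laplaceD.
  - by apply: has_laplaceZ; exact: has_laplaceD.
  - apply: filterS2 h0M h0m => t h0M h0m Rt.
    have t0 : 0 < t by move: Rt; rewrite /= in_itv/= andbT.
    rewrite /I indicE; have [Tt|tT] := leP T t.
      by rewrite mem_set/= ?in_itv/= ?Tt// mulr1 addrC subrK; exact: h0M.
    rewrite memNset/= ?in_itv/= ?andbT; last by apply/negP; rewrite -ltNge.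
    by rewrite mulr0 addr0; apply: h0m; rewrite /= in_itv/= t0.
  (* The jump at [T] contributes the delay [expR (- (T s))] times [(c - Q) / s], where [Q] is the
     power of the symbol. *)
  apply: eq_cm (cmD (cmZ m0 cdiff) (cmZ Mm (cmM (cm_expR (ltW T0)) crQ))) => s s0.
  rewrite (rlaplaceZ c (has_laplaceD hmE hMI) s0) (rlaplaceD hmE hMI s0) (rlaplaceD hC hMI s0).
  rewrite (rlaplaceZ m hE' s0) (rlaplaceZ (M - m) hI s0).
  rewrite rlaplace_cst// rlaplace_erfc// rlaplace_indic//.
  by field; rewrite gt_eqF.
apply: filterS key => t key; rewrite /= in_itv/= => /andP[t0 tT].
have {key} := key _; rewrite /= in_itv/= andbT => /(_ t0).
rewrite /I indicE memNset/= ?in_itv/= ?andbT; last by apply/negP; rewrite -ltNge.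
rewrite mulr0 addr0 => /le_trans; apply.
(* Since [t < T], monotonicity of [erfc] replaces [t] by [T]. *)
rewrite -mulrA ler_wpM2l// mulrC ler_wpM2r//; apply: erfc_noninc.
rewrite ler_pM2l// lef_pV2 ?posrE ?mulr_gt0 ?sqrtr_gt0// ler_pM2l// ler_sqrt; lra.
Qed.

End dnwr.

Theorem theorem2p2 (R : realType) (a b : R) (h : nat -> R -> R)
    (hb : 0 < b) (hab : b < a) (hh : dnwr_iteration a b (1 / 2) h) :
  (forall k : nat, (0 < k)%N ->
     (Linfty_norm `]0%R, +oo[ (h k)
        <= (((a - b) / (2 * a)) ^+ k)%R%:E * Linfty_norm `]0%R, +oo[ (h 0%N))%E) /\
  (forall T : R, 0 < T -> forall k : nat, (0 < k)%N ->
     (Linfty_norm `]0%R, T[ (h k)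
        <= (((a - b) / a) ^+ k * erfc (k%:R * b / (2 * Num.sqrt T)))%R%:E
           * Linfty_norm `]0%R, T[ (h 0%N))%E).
Proof.
have ge0 D := Linfty_norm_ge0 D (h 0%N).
have fin D : D `<=` `]0, +oo[ -> Linfty_norm D (h 0%N) \is a fin_num.
  move=> D0; rewrite ge0_fin_numE//; case: hh => + _; apply: le_lt_trans.
  exact: Linfty_norm_subset.
have ae_le D : D `<=` `]0, +oo[ -> {ae lebesgue_measure, forall t, D t ->
    `|h 0%N t| <= fine (Linfty_norm D (h 0%N))}.
  move=> D0; apply: filterS (Linfty_norm_ge D (h 0%N)) => t ht Dt.
  by rewrite -lee_fin fineK ?fin// ht.
have subT (T : R) : `]0, T[ `<=` `]0, +oo[ by apply: subset_itvl.
split=> [k _|T T0 k k0].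
  rewrite -(fineK (fin _ (@subset_refl _ _))) -EFinM.
  have M0 : 0 <= fine (Linfty_norm `]0, +oo[ (h 0%N)) by exact: fine_ge0.
  apply: Linfty_norm_le; last by apply: dnwr_linear => //; exact: ae_le.
  by rewrite mulr_ge0// exprn_ge0// divr_ge0; lra.
rewrite -(fineK (fin _ (subT T))) -EFinM.
have m0 : 0 <= fine (Linfty_norm `]0, T[ (h 0%N)) by exact: fine_ge0.
apply: Linfty_norm_le.
  by rewrite mulr_ge0// mulr_ge0 ?erfc_ge0// exprn_ge0// divr_ge0; lra.
(* The global norm only supplies a finite bound for the data after [T]. *)
apply: (@dnwr_superlinear _ a b T _ (fine (Linfty_norm `]0, +oo[ (h 0%N)))) => //.
- by apply: fine_le; rewrite ?fin//; exact: Linfty_norm_subset.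
- exact: ae_le.
- exact: ae_le.
Qed.
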